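(* If $C^{(n)}$ is distributed as the cycle counts of a uniformly random permutation of $[n]$ (ESF$(1)$), then \[\sup_{x\in\mathbb{R}}\left|\mathbb{P}\!\left(\frac{\log\mathsf{invol}_n(C^{(n)})-\frac12\log^2 n}{\sqrt{\frac13\log^3 n}}\le x\right)-\Phi(x)-\frac{3^{3/2}}{24\sqrt{2\pi}}\frac{(1-x^2)e^{-x^2/2}}{\sqrt{\log n}}\right|\ll\left(\frac{\log\log n}{\log n}\right)^{\frac23},\] where $\Phi$ is the standard normal distribution function.
   Context: Cycle counts: $c_k$ = number of cycles of length $k$. For a nonnegative integer vector $a$: $\mathsf{invol}_n(a)=\prod_{k=1}^n k^{a_k}\sum_{j=0}^{\lfloor a_k/2\rfloor}\frac{(a_k)_{2j}}{(2k)^j j!}$ with $(x)_r=x(x-1)\cdots(x-r+1)$; for the cycle counts of $\sigma\in\mathfrak{S}_n$ this equals the number of ordered pairs of involutions $(\tau_1,\tau_2)$ in $\mathfrak{S}_n$ with $\sigma=\tau_2\circ\tau_1$. The symbol $\ll$ means bounded by a constant multiple, for all sufficiently large $n$. *)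

(* Defs.v *)
From mathcomp Require Import all_boot fingroup perm.
From Stdlib Require Import Reals.
From Coquelicot Require Import Coquelicot.

Set Implicit Arguments.
Unset Strict Implicit.
Unset Printing Implicit Defensive.

Definition cycle_count (n : nat) (s : 'S_n) (k : nat) : nat :=
  #|[set C in porbits s | #|C| == k]|.

Fixpoint prodR_1n (f : nat -> R) (n : nat) : R :=
  match n with
  | O => 1%R
  | S m => (prodR_1n f m * f (S m))%R
  end.

Definition invol_factor (k a : nat) : R :=
  (INR (k ^ a) *
   sum_f_R0 (fun j => INR (a ^_ (2 * j)) / (INR ((2 * k) ^ j) * INR (j `!)))
            (a %/ 2))%R.

Definition invol (n : nat) (a : nat -> nat) : R :=
  prodR_1n (fun k => invol_factor k (a k)) n.

Definition Rleb (x y : R) : bool := if Rle_dec x y then true else false.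

Definition stat (n : nat) (s : 'S_n) : R :=
  ((ln (invol n (cycle_count s)) - / 2 * (ln (INR n)) ^ 2)
     / sqrt (/ 3 * (ln (INR n)) ^ 3))%R.

Definition prob_stat_le (n : nat) (x : R) : R :=
  (INR #|[set s : 'S_n | Rleb (stat s) x]| / INR (n `!))%R.

Definition Phi (x : R) : R :=
  RInt_gen (fun t => exp (- t ^ 2 / 2) / sqrt (2 * PI))%R
           (Rbar_locally m_infty) (at_point x).

(* Main.v *)
Require Import Defs.
From HB Require Import structures.
From mathcomp Require Import all_boot fingroup perm.
From mathcomp Require Import zify.
From Stdlib Require Import Reals Lra Psatz FunctionalExtensionality.
From Coquelicot Require Import Coquelicot.

(** Let [X = \sum_k C_k log k]. As [1 <= \sum_j (a)_{2j} / ((2k)^j j!) <= exp (a (a - 1) / (2k))],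
    [log invol] exceeds [X] by a nonnegative error of bounded mean, so only [X] matters.

    Reading off the cycles one by one, each length [k] is uniform on the [m] points left, and so is
    [m + 1 - k]. Replacing every [log k] by [log (m + 1 - k)] turns [X] into
    [X' = \sum_j xi_j log j] with [xi_j] independent Bernoulli of parameter [1 / j] (the Feller
    coupling), and by this symmetry the increments of [X - X'] are centred with bounded variance, so that
    [E (X - X')^2 << log n]. On the scale [(log n)^{3/2}], Chebyshev's inequality makes this cost
    [(log n)^{-2/3}], which is where the exponent comes from.

    With [L = log n], the characteristic function of [X'] at [th] is
    [exp (\int_0^L (cis (th u) - 1) du) (1 + O(th))]. Smoothing the normalised [X'] by a normal law of
    standard deviation [1 / L] and inverting Gaussian Fourier integrals, its density is within
    [O(1 / L)] of the Edgeworth density, uniformly. Integrating over [|x| <= L^{1/3}], where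
    the conservation of mass also controls the tails, gives distribution functions within
    [O(L^{-2/3})]. *)

Set Implicit Arguments.
Unset Strict Implicit.
Unset Printing Implicit Defensive.
Local Open Scope R_scope.

(** The characteristic function is approximated well only for [th <= 1], that is for [t] up to
    [sg L], of order [L^{3/2}]. Beyond that the only bound available on its modulus is 1, and this
    is what forces the smoothing: the normal law of standard deviation [1 / L] contributes the
    factor [gauss (t / L)], which is already [exp (- L / 6)] at [t = sg L]. On the other hand
    [1 / L] is far below [L^{-2/3}], the shift of [x] that the final error allows, so undoing the
    smoothing costs only [Phi (- L^{1/3})]. Densities are compared rather than distribution
    functions because Fourier inversion of a distribution function divides by [t]. For densities the
    error [K / (L * (1 + t^2))] is integrated as it stands, against an arctangent. The price is a
    factor [L^{1/3}], the length of the interval over which densities are integrated afterwards, and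
    the target accuracy leaves room for exactly that. All integrals are real and over [[0, T]].
    Every limit in [T] follows from an explicit bound on the Gaussian tail. *)

HB.instance Definition _ := Monoid.isComLaw.Build R 0 Rplus
  (fun a b c => esym (Rplus_assoc a b c)) Rplus_comm Rplus_0_l.
HB.instance Definition _ := Monoid.isMulLaw.Build R 0 Rmult Rmult_0_l Rmult_0_r.
HB.instance Definition _ :=
  Monoid.isAddLaw.Build R Rmult Rplus Rmult_plus_distr_r Rmult_plus_distr_l.

Local Notation "\rsum_ ( i < n ) F" := (\big[Rplus/0]_(i < n) F)
  (at level 41, F at level 41, i, n at level 50).

#[local] Arguments INR : simpl never.

Lemma INR_S_neq0 (n : nat) : INR n.+1 <> 0.
Proof. exact: not_0_INR. Qed.

Lemma INR_S_gt0 (n : nat) : 0 < INR n.+1.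
Proof. by apply: lt_0_INR; lia. Qed.

Lemma exp_INR_mul (n : nat) (x : R) : exp (INR n * x) = exp x ^ n.
Proof.
elim: n => [|n IH]; first by rewrite INR_0 Rmult_0_l exp_0.
by rewrite S_INR Rmult_plus_distr_r Rmult_1_l exp_plus IH Rmult_comm.
Qed.

(** * Cycle counts of uniform permutations *)

Section CycleCounts.
Variable T : finType.
Implicit Types (A B C D : {set T}) (s t : {perm T}) (P : (nat -> nat) -> bool).

(** The condition [C \subset A] discards the fixed points outside [A], so that permutations of all
    subsets can be counted inside the single type [{perm T}]. *)
Definition cycle_count_in A s (k : nat) : nat :=
  #|[set C in porbits s | (C \subset A) && (#|C| == k)]|.

Definition count_plus (k : nat) (c : nat -> nat) (j : nat) : nat := (c j + (j == k))%nat.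

Definition perm_count A P : nat := #|[set s | perm_on A s && P (cycle_count_in A s)]|.

Lemma porbit_agree s t (z : T) :
  {in porbit s z, t =1 s} -> porbit t z = porbit s z.
Proof.
move=> ag.
have e i : (t ^+ i)%g z = (s ^+ i)%g z.
  elim: i => [|i IH]; first by rewrite !expg0.
  by rewrite !expgSr !permM IH ag // mem_porbit.
by apply/setP => u; apply/porbitP/porbitP => -[i ->]; exists i; rewrite e.
Qed.

Lemma porbits_agree s t C : {in C, t =1 s} -> (C \in porbits s) = (C \in porbits t).
Proof.
move=> ag; apply/imsetP/imsetP => -[z _ e]; exists z => //.
  by rewrite e; apply/esym/porbit_agree; rewrite -e.
by rewrite e; apply/esym/porbit_agree; rewrite -e => u uC; rewrite ag.
Qed.

Lemma cycle_count_in_agree A s t :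
  {in A, t =1 s} -> cycle_count_in A s = cycle_count_in A t.
Proof.
move=> ag; apply: functional_extensionality => k; congr #|pred_of_set _|.
apply/setP => C; rewrite !inE.
case: (boolP (C \subset A)) => [/subsetP sCA|]; last by rewrite !andbF.
by rewrite (@porbits_agree s t) // => u /sCA; exact: ag.
Qed.

Lemma porbit_closed s A (z : T) : perm_on A s -> z \in A -> porbit s z \subset A.
Proof.
move=> sA zA; apply/subsetP => _ /porbitP [i ->].
by elim: i => [|i IH]; rewrite ?expg0 ?perm1 // expgSr permM perm_closed.
Qed.

(* [tperm x y * s] inserts [x] right after [y] in its cycle. *)
Lemma porbit_insert s (x y : T) : s x = x -> y != x ->
  porbit (tperm x y * s)%g x = x |: porbit s y.
Proof.
move=> sx nyx; set t := (tperm x y * s)%g.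
have tx : t x = s y by rewrite permM tpermL.
have ty : t y = x by rewrite permM tpermR.
have tz z : z != x -> z != y -> t z = s z.
  by move=> zx zy; rewrite permM tpermD // eq_sym.
have nx : x \notin porbit s y.
  rewrite porbit_sym; apply/porbitP => -[i].
  have -> : (s ^+ i)%g x = x by elim: i => [|i IH]; rewrite ?expg0 ?perm1 // expgSr permM IH.
  by move/eqP; rewrite (negbTE nyx).
have cl i : (t ^+ i)%g x \in x |: porbit s y.
  elim: i => [|i IH]; first by rewrite expg0 perm1 !inE eqxx.
  rewrite expgSr permM; move: IH; move: ((t ^+ i)%g x) => u; rewrite !inE.
  case: (eqVneq u x) => [-> _|ux /= us]; first by rewrite tx (mem_porbit s 1) orbT.
  case: (eqVneq u y) => [->|uy]; first by rewrite ty eqxx.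
  by rewrite tz // -eq_porbit_mem (porbit_perm s 1) eq_porbit_mem us orbT.
have inO i : (s ^+ i)%g y \in porbit t x.
  elim: i => [|i IH].
    by rewrite expg0 perm1 porbit_sym -{1}ty (mem_porbit t 1).
  rewrite expgSr permM; move: IH (mem_porbit s i y); move: ((s ^+ i)%g y) => u uO us.
  case: (eqVneq u y) => [->|uy]; first by rewrite -tx (mem_porbit t 1).
  have ux : u != x by apply: contraNneq nx => <-.
  by rewrite -tz // -eq_porbit_mem (porbit_perm t 1) eq_porbit_mem.
apply/setP => u; apply/porbitP/setU1P => [[i ->]|[->|/porbitP [i ->]]].
- by apply/setU1P; exact: cl.
- by exists 0%nat; rewrite expg0 perm1.
- by apply/porbitP; exact: inO.
Qed.

(** Induction on [#|B|]. If [B] is not reduced to [x], the preimage [y] of [x] is one of the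
    [#|B|.-1] other points of [B], and removing [x] from its cycle leaves a permutation whose cycle
    through [y] is [B :\ x]. Nothing changes on [A], so the cycle counts there are preserved. *)
Lemma card_cycle_through A B P (x : T) : x \in B -> [disjoint A & B] ->
  #|[set s | [&& perm_on (A :|: B) s, porbit s x == B & P (cycle_count_in A s)]]|
  = ((#|B|.-1)`! * perm_count A P)%nat.
Proof.
move: {2}(#|B|.-1) (erefl #|B|.-1) => b.
elim: b B x => [|b IH] B x cB xB dAB.
  have Bx : B = [set x].
    apply/eqP; rewrite eq_sym eqEcard sub1set xB cards1 /=.
    by rewrite -(prednK (n := #|B|)) ?cB //; apply/card_gt0P; exists x.
  have xA : x \notin A.
    by move: dAB; rewrite Bx disjoint_sym disjoints1.
  rewrite cB fact0 mul1n; apply: eq_card => s; rewrite !inE.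
  case: (P _); rewrite ?andbF // !andbT Bx; apply/andP/idP => [[sU /eqP sx]|sA].
    have fx : s x = x by apply/eqP; rewrite -in_set1 -sx (mem_porbit s 1).
    apply/subsetP => z; rewrite inE => sz.
    have := subsetP sU z; rewrite !inE sz => /(_ isT) /orP [//|/eqP ez].
    by move: sz; rewrite ez fx eqxx.
  split; first by apply: subset_trans sA (subsetUl _ _).
  have fx : s x = x by apply: out_perm xA.
  apply/eqP/setP => u; rewrite inE; apply/porbitP/eqP => [[i ->]|->].
    by elim: i => [|i IH]; rewrite ?expg0 ?perm1 // expgSr permM IH.
  by exists 0%nat; rewrite expg0 perm1.
set B' := B :\ x.
have cB' : #|B'| = b.+1 by have := cardsD1 x B; rewrite xB /B'; lia.
have BE : B = x |: B' by rewrite /B' setD1K.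
have xB' : x \notin B' by rewrite !inE eqxx.
have xA : x \notin A by move: (disjointFl dAB xB) => ->.
have dAB' : [disjoint A & B'] by apply: disjointWr dAB; rewrite BE subsetUr.
have -> : ((#|B|.-1)`! * perm_count A P)%nat = (\sum_(y in B') (b`! * perm_count A P))%nat.
  by rewrite sum_nat_const cB' cB factS mulnA.
rewrite -sum1_card (partition_big (fun s : {perm T} => (s^-1)%g x) (mem B')) /=; last first.
  move=> s; rewrite !inE => /and3P [_ /eqP so _]; apply/andP; split.
    apply/eqP => fx; have sx : s x = x by rewrite -{1}fx permKV.
    suff: porbit s x = [set x] by rewrite so => e; move: cB; rewrite e cards1.
    apply/setP => u; rewrite inE; apply/porbitP/eqP => [[i ->]|->].
      by elim: i => [|i IHi]; rewrite ?expg0 ?perm1 // expgSr permM IHi.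
    by exists 0%nat; rewrite expg0 perm1.
  by rewrite -so -porbitV (mem_porbit (s^-1)%g 1).
apply: eq_bigr => y yB'.
have nyx : y != x by apply: contraNneq xB' => <-.
have yA : y \notin A by move: (disjointFl dAB' yB') => ->.
have := IH B' y; rewrite cB' /= => /(_ erefl yB' dAB') <-.
(* Left multiplication by [tperm x y] is injective and is its own inverse; it inserts [x] after [y]
   or removes it again. *)
rewrite sum1_card -[RHS](card_imset _ (mulgI (tperm x y))).
apply: eq_card => t; rewrite [LHS]unfold_in.
have agree s : {in A, (tperm x y * s)%g =1 s}.
  move=> z zA; rewrite permM tpermD //.
    by apply: contraNneq xA => ->.
  by apply: contraNneq yA => ->.
apply/idP/imsetP => [|[s]]; rewrite !inE.
  case/andP => /and3P [tU /eqP tO Pt] /eqP ty; exists (tperm x y * t)%g; last first.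
    by rewrite mulgA tperm2 mul1g.
  set s := (tperm x y * t)%g.
  have tE : t = (tperm x y * s)%g by rewrite mulgA tperm2 mul1g.
  have sx : s x = x by rewrite permM tpermL -ty permKV.
  rewrite inE; apply/and3P; split.
  - apply/subsetP => z; rewrite inE => sz.
    have zx : z != x by apply: contraNneq sz => ->; rewrite sx.
    case: (eqVneq z y) => [->|zy]; first by rewrite inE yB' orbT.
    move: sz; rewrite permM tpermD; [move=> tz|by rewrite eq_sym..].
    by have := subsetP tU z; rewrite !inE tz (negbTE zx) => /(_ isT).
  - have := porbit_insert sx nyx; rewrite -tE tO => e.
    apply/eqP; rewrite /B' e setU1K //; rewrite porbit_sym.
    apply/porbitP => -[i].
    have -> : (s ^+ i)%g x = x.
      by elim: i => [|i IHi]; rewrite ?expg0 ?perm1 // expgSr permM IHi.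
    by move/eqP; rewrite (negbTE nyx).
  - by rewrite (cycle_count_in_agree (s := s) (t := t)) // tE; exact: agree.
case/and3P => sU /eqP sO Ps ->.
have sx : s x = x by apply: out_perm sU _; rewrite inE negb_or xA.
rewrite -(cycle_count_in_agree (agree s)) Ps porbit_insert // sO -BE eqxx /= andbT.
apply/andP; split; last first.
  apply/eqP/(@perm_inj _ (tperm x y * s)%g).
  by rewrite permKV permM tpermR.
apply: perm_onM.
  apply: subset_trans (tperm_on _ _) _; apply/subsetP => z; rewrite !inE.
  by case/orP => /eqP ->; rewrite ?xB ?nyx ?orbT //; move: yB'; rewrite !inE => /andP [_ ->]; rewrite orbT.
apply: subset_trans sU _; rewrite BE; apply: setUS; exact: subsetUr.
Qed.

Lemma cycle_count_in_split A s (x : T) : perm_on A s -> x \in A ->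
  cycle_count_in A s
  = count_plus #|porbit s x| (cycle_count_in (A :\: porbit s x) s).
Proof.
move=> sA xA; apply: functional_extensionality => k; rewrite /count_plus /cycle_count_in.
set B := porbit s x.
have BA : B \subset A by apply: porbit_closed.
have Bin : B \in porbits s by apply: imset_f.
have ne C : C \in porbits s -> C \subset A :\: B -> C != B.
  move=> /imsetP [z _ ->] /subsetP /(_ z (porbit_id s z)); rewrite inE => /andP [zB _].
  by apply: contraNneq zB => <-; rewrite porbit_id.
rewrite (cardsD1 B) inE Bin BA eq_sym addnC /=; congr addn.
apply: eq_card => C; rewrite !inE.
case: (boolP (C \in porbits s)) => [Cs|]; last by rewrite andbF.
case: (eqVneq C B) => [->|nCB] /=.
  by case: (boolP (B \subset _)) => // h; have := ne _ Bin h; rewrite eqxx.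
congr andb; rewrite subsetD; case: (C \subset A) => //=.
apply/esym; move/imsetP: Cs nCB => [z _ ->] nzx.
rewrite disjoint_subset; apply/subsetP => u uz; rewrite inE; apply/negP => ux.
move: nzx; rewrite (eqP (_ : porbit s z == porbit s x)) ?eqxx //.
by rewrite eq_porbit_mem; move: uz; rewrite -eq_porbit_mem => /eqP uz; rewrite porbit_sym -eq_porbit_mem eq_sym -uz eq_porbit_mem.
Qed.

Lemma perm_count_rec A P (x : T) : x \in A ->
  perm_count A P = (\sum_(B : {set T} | (x \in B) && (B \subset A))
     (#|B|.-1)`! * perm_count (A :\: B) (fun c => P (count_plus #|B| c)))%nat.
Proof.
move=> xA; rewrite {1}/perm_count -sum1_card.
rewrite (partition_big (fun s : {perm T} => porbit s x)
           (fun B => (x \in B) && (B \subset A))) /=; last first.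
  by move=> s; rewrite inE => /andP [sA _]; rewrite porbit_id porbit_closed.
apply: eq_bigr => B /andP [xB BA].
have d : [disjoint A :\: B & B] by apply/pred0P => z; rewrite /= !inE; case: (z \in B); rewrite ?andbF.
rewrite -(card_cycle_through (fun c => P (count_plus #|B| c)) xB d) sum1_card.
have -> : (A :\: B) :|: B = A by rewrite setUC -{2}(setID A B) (setIidPr BA).
apply: eq_card => s; rewrite unfold_in !inE.
case: (boolP (perm_on A s)) => //= sA.
case: eqP => [e|]; last by rewrite andbF.
by rewrite andbT (cycle_count_in_split sA xA) e.
Qed.

End CycleCounts.

(** * The law of the successive cycle lengths *)

Lemma INR_sum (I : finType) (Q : pred I) (F : I -> nat) :
  INR (\sum_(i | Q i) F i)%nat = \big[Rplus/0]_(i | Q i) INR (F i).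
Proof. by apply: (big_morph INR); [exact: plus_INR|]. Qed.

Lemma rsum_le (n : nat) (f g : nat -> R) :
  (forall i, (i < n)%nat -> f i <= g i) -> \rsum_(i < n) f i <= \rsum_(i < n) g i.
Proof.
move=> h; apply: (big_ind2 (fun a b => a <= b)).
- exact: Rle_refl.
- by move=> *; lra.
- by move=> i _; apply: h.
Qed.

Lemma rsum_const (n : nat) (c : R) : \rsum_(i < n) c = INR n * c.
Proof.
elim: n => [|n IH]; first by rewrite big_ord0 INR_0; ring.
by rewrite big_ord_recr IH S_INR /=; ring.
Qed.

Lemma rsum_const_in (I : finType) (Q : pred I) (c : R) :
  \big[Rplus/0]_(i in Q) c = INR #|Q| * c.
Proof.
rewrite big_const; elim: #|Q| => [|n IH]; first by rewrite INR_0 /=; ring.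
by rewrite iterS IH S_INR; ring.
Qed.

(** With [i] points left after the first cycle, its length is [n.+1 - i]. This reversal expresses
    that the length and the number of points left plus one have the same law. *)
Lemma rsum_rev (n : nat) (f : nat -> R) :
  \rsum_(i < n.+1) f (n.+1 - i)%nat = \rsum_(i < n.+1) f i.+1.
Proof.
rewrite (reindex_inj rev_ord_inj) /=; apply: eq_bigr => i _; congr f.
by have := ltn_ord i; lia.
Qed.

(* The law of the successive cycle lengths of a uniform permutation, each cycle being the one
   through the least point not yet covered: its length is uniform on the [n] points left. *)
Fixpoint Ecyc_fuel (fuel n : nat) (g : seq nat -> R) : R :=
  match fuel, n with
  | f.+1, m.+1 =>
      / INR m.+1 * \rsum_(i < m.+1) Ecyc_fuel f i (fun l => g ((m.+1 - i)%nat :: l))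
  | _, _ => g [::]
  end.

Definition Ecyc (n : nat) (g : seq nat -> R) : R := Ecyc_fuel n n g.

(** The recursive call is at an arbitrary [i < m.+1], hence the fuel. Each cycle consumes one unit
    of fuel and at least one point, so [n] units are enough. *)
Lemma Ecyc_fuelE (f1 f2 n : nat) (g : seq nat -> R) :
  (n <= f1)%nat -> (n <= f2)%nat -> Ecyc_fuel f1 n g = Ecyc_fuel f2 n g.
Proof.
elim: f1 f2 n g => [|f1 IH] [|f2] [|n] g //= h1 h2.
congr Rmult; apply: eq_bigr => i _; apply: IH; have := ltn_ord i; lia.
Qed.

Lemma Ecyc0 (g : seq nat -> R) : Ecyc 0 g = g [::].
Proof. by []. Qed.

Lemma EcycS (n : nat) (g : seq nat -> R) :
  Ecyc n.+1 g
  = / INR n.+1 * \rsum_(i < n.+1) Ecyc i (fun l => g ((n.+1 - i)%nat :: l)).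
Proof.
congr Rmult; apply: eq_bigr => i _; apply: Ecyc_fuelE => //.
by have := ltn_ord i; lia.
Qed.

Lemma EcycSm (n : nat) (g : seq nat -> R) :
  INR n.+1 * Ecyc n.+1 g = \rsum_(i < n.+1) Ecyc i (fun l => g ((n.+1 - i)%nat :: l)).
Proof. by rewrite EcycS; field; exact: INR_S_neq0. Qed.

(** The law is carried by lists of positive parts with sum [n]. Restricting the hypothesis to them
    is what later allows [sumn l] to be replaced by its value in [log_remainders]. *)
Lemma Ecyc_le (n : nat) (g h : seq nat -> R) :
  (forall l, sumn l = n -> all (fun k => 0 < k)%nat l -> g l <= h l) -> Ecyc n g <= Ecyc n h.
Proof.
elim/ltn_ind: n g h => -[|n] IH g h gh; first by apply: gh.
rewrite !EcycS; apply: Rmult_le_compat_l.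
  exact: Rlt_le (Rinv_0_lt_compat _ (INR_S_gt0 n)).
apply: (@rsum_le _ (fun i => Ecyc i (fun l => g ((n.+1 - i)%nat :: l)))
                   (fun i => Ecyc i (fun l => h ((n.+1 - i)%nat :: l)))) => i hi.
by apply: IH => // l sl al; apply: gh => /=; rewrite ?sl ?al ?andbT; lia.
Qed.

Lemma Ecyc_ext (n : nat) (g h : seq nat -> R) :
  (forall l, sumn l = n -> all (fun k => 0 < k)%nat l -> g l = h l) -> Ecyc n g = Ecyc n h.
Proof.
by move=> gh; apply: Rle_antisym; apply: Ecyc_le => l sl al; rewrite gh //; lra.
Qed.

Lemma Ecyc_lin (n : nat) (a b : R) (g h : seq nat -> R) :
  Ecyc n (fun l => a * g l + b * h l) = a * Ecyc n g + b * Ecyc n h.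
Proof.
elim/ltn_ind: n g h => -[|n] IH g h //.
rewrite !EcycS; under eq_bigr => i _ do rewrite IH //.
by rewrite big_split /= -!big_distrr /=; ring.
Qed.

Lemma Ecyc_const (n : nat) (c : R) : Ecyc n (fun=> c) = c.
Proof.
elim/ltn_ind: n => -[|n] IH //.
rewrite EcycS (eq_bigr (fun=> c)) => [|i _]; last by rewrite IH.
by rewrite rsum_const; field; exact: INR_S_neq0.
Qed.

Lemma EcycD (n : nat) (g h : seq nat -> R) :
  Ecyc n (fun l => g l + h l) = Ecyc n g + Ecyc n h.
Proof.
rewrite -[RHS](_ : 1 * Ecyc n g + 1 * Ecyc n h = _); last by ring.
by rewrite -Ecyc_lin; apply: Ecyc_ext => l _ _; ring.
Qed.

Lemma EcycZ (n : nat) (a : R) (g : seq nat -> R) :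
  Ecyc n (fun l => a * g l) = a * Ecyc n g.
Proof.
rewrite -[RHS](_ : a * Ecyc n g + 0 * Ecyc n g = _); last by ring.
by rewrite -Ecyc_lin; apply: Ecyc_ext => l _ _; ring.
Qed.

Lemma count_mem_cons (k : nat) (l : seq nat) :
  (fun j => count_mem j (k :: l)) = count_plus k (fun j => count_mem j l).
Proof.
by apply: functional_extensionality => j; rewrite /count_plus /= addnC eq_sym.
Qed.

(** Let [D] be the set of points of [A] outside the cycle of [x], where [#|A| = m.+1]. There are
    ['C(m, i)] choices of [D] of size [i], each with [(m - i)!] cycles on the complement and [i!]
    permutations of [D]. The product is [m!] whatever [i] is, so [#|D|] is uniform on [0, ..., m],
    as in the recursion of [Ecyc]. *)
Lemma perm_count_Ecyc (T : finType) (A : {set T}) (P : (nat -> nat) -> bool) :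
  INR (perm_count A P)
  = INR (#|A|`!) * Ecyc #|A| (fun l => INR (P (fun j => count_mem j l))).
Proof.
have [n] := ubnP #|A|; elim: n A P => // n IH A P; rewrite ltnS => cA.
case: (set_0Vmem A) => [->|[x xA]].
  rewrite cards0 Ecyc0 fact0 Rmult_1_l /perm_count.
  have e s : cycle_count_in (set0 : {set T}) s = (fun=> 0%nat).
    apply: functional_extensionality => k; apply/eqP; rewrite cards_eq0; apply/eqP/setP => C.
    rewrite !inE; apply/negP => /and3P [/imsetP [z _ ->]].
    by rewrite subset0 => /eqP e; move: (porbit_id s z); rewrite e inE.
  rewrite -[X in INR (nat_of_bool (P X))]/(fun=> 0%nat).
  congr INR; case: (boolP (P (fun=> 0%nat))) => p0.
    rewrite -[RHS](cards1 (1%g : {perm T})); apply: eq_card => s; rewrite !inE e p0 andbT.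
    by apply/idP/eqP => [/perm_on_id ->|->]; rewrite ?cards0 ?perm_on1.
  by apply: eq_card0 => s; rewrite !inE e (negbTE p0) andbF.
case cAS: #|A| cA => [|m] cA; first by move: xA; rewrite (cards0_eq cAS) inE.
have cAx : #|A :\ x| = m by have := cardsD1 x A; rewrite xA cAS; lia.
rewrite (perm_count_rec P xA) INR_sum.
rewrite (reindex_onto (fun D => A :\: D) (fun B => A :\: B)) /=; last first.
  by move=> B /andP [_ BA]; rewrite setDDr setDv set0U (setIidPr BA).
pose h i := Ecyc i (fun l => INR (P (fun j => count_mem j ((m.+1 - i)%nat :: l)))).
transitivity (\big[Rplus/0]_(D : {set T} | D \subset A :\ x)
                (INR ((m - #|D|)`! * (#|D|)`!)%nat * h #|D|)).
  apply: eq_big => D.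
    rewrite inE xA andbT subsetD1 subsetDl andbT.
    apply/andP/andP => [[xD /eqP DA]|[DA xD]]; first by rewrite -{1}DA subsetDl.
    by rewrite setDDr setDv set0U (setIidPr DA).
  move=> /andP [/andP [xD _] /eqP DA]; rewrite DA.
  have DsA : D \subset A by rewrite -DA subsetDl.
  have cD : #|A :\: D| = (m.+1 - #|D|)%nat by rewrite cardsD (setIidPr DsA) cAS.
  have Dm : (#|D| <= m)%nat.
    by rewrite -cAx; apply: subset_leq_card; rewrite subsetD1 DsA; move: xD; rewrite inE => /andP [].
  rewrite mulnE !mult_INR IH; last by lia.
  rewrite Rmult_assoc cD; congr Rmult; first by congr INR; congr factorial; lia.
  congr Rmult; apply: Ecyc_ext => l _ _; by rewrite count_mem_cons.
rewrite (partition_big (fun D : {set T} => inord #|D|) (fun _ : 'I_m.+1 => true)) //=.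
have -> : INR (m.+1)`! * Ecyc m.+1 (fun l => INR (P (fun j => count_mem j l)))
          = INR m`! * (INR m.+1 * Ecyc m.+1 (fun l => INR (P (fun j => count_mem j l)))).
  by rewrite factS mulnE mult_INR; ring.
rewrite EcycSm big_distrr /=; apply: eq_bigr => i _.
have im : (i <= m)%nat by rewrite -ltnS.
transitivity (\big[Rplus/0]_(D in [set D : {set T} | D \subset A :\ x & #|D| == i])
                (INR ((m - i)`! * i`!)%nat * h i)).
  apply: eq_big => D.
    rewrite inE; case: (boolP (D \subset _)) => //= DA.
    rewrite -val_eqE /= inordK //.
    by rewrite ltnS -cAx; apply: subset_leq_card.
  move=> /andP [DA /eqP <-]; rewrite inordK //.
  by rewrite ltnS -cAx; apply: subset_leq_card.
rewrite rsum_const_in cards_draws cAx -Rmult_assoc -mult_INR; congr Rmult; congr INR.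
by rewrite multE -(bin_fact im) [(i`! * _)%nat]mulnC.
Qed.

Lemma perm_prob_Ecyc (n : nat) (P : (nat -> nat) -> bool) :
  INR #|[set s : 'S_n | P (cycle_count s)]| / INR (n`!)
  = Ecyc n (fun l => INR (P (fun j => count_mem j l))).
Proof.
have -> : #|[set s : 'S_n | P (cycle_count s)]| = perm_count [set: 'I_n] P.
  apply: eq_card => s; rewrite !inE.
  have -> : perm_on [set: 'I_n] s by apply/subsetP => z; rewrite inE.
  congr P; apply: functional_extensionality => k.
  by apply: eq_card => C; rewrite !inE subsetT.
rewrite perm_count_Ecyc cardsT card_ord; field.
by apply: not_0_INR; apply/eqP; rewrite -lt0n fact_gt0.
Qed.

(** * Coupling with independent Bernoulli variables *)

Fixpoint log_lengths (l : seq nat) : R :=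
  if l is k :: l' then ln (INR k) + log_lengths l' else 0.

(* If [l] lists the successive cycle lengths, [sumn l'] points remain after the first cycle;
   [(sumn l').+1] has the same law as the cycle length [k] itself. *)
Fixpoint log_remainders (l : seq nat) : R :=
  if l is k :: l' then ln (INR (sumn l').+1) + log_remainders l' else 0.

(** This is the sum over [k] of ['C(c_k, 2) / k], the exponent in the upper bound on [invol].
    Counting pairs of equal lengths cycle by cycle lets its mean be computed by the recursion of
    [Ecyc]. *)
Fixpoint repeated_lengths (l : seq nat) : R :=
  if l is k :: l' then INR (count_mem k l') / INR k + repeated_lengths l' else 0.

Definition harmonic (n : nat) : R := \rsum_(i < n) / INR i.+1.

Lemma harmonicS (n : nat) : harmonic n.+1 = harmonic n + / INR n.+1.
Proof. by rewrite /harmonic big_ord_recr. Qed.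

Lemma ln_le_sub1 (x : R) : 0 < x -> ln x <= x - 1.
Proof. by move=> x0; have := exp_ineq1_le (ln x); rewrite exp_ln //; lra. Qed.

Lemma ln_ge_1_sub_inv (x : R) : 0 < x -> 1 - / x <= ln x.
Proof.
move=> x0; have := ln_le_sub1 (Rinv_0_lt_compat _ x0); rewrite ln_Rinv //; lra.
Qed.

Lemma harmonic_le (n : nat) : harmonic n.+1 <= 1 + ln (INR n.+1).
Proof.
elim: n => [|n IH]; first by rewrite /harmonic big_ord_recl big_ord0 /= INR_1 ln_1; lra.
rewrite harmonicS.
have a0 := INR_S_gt0 n; have b0 := INR_S_gt0 n.+1.
have := ln_ge_1_sub_inv (Rdiv_lt_0_compat _ _ b0 a0); rewrite ln_div //.
have -> : / (INR n.+2 / INR n.+1) = 1 - / INR n.+2.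
  by rewrite (S_INR n.+1); field; rewrite -S_INR; split; exact: INR_S_neq0.
lra.
Qed.

Lemma sum_harmonic (n : nat) :
  \rsum_(i < n.+1) harmonic i = INR n.+1 * (harmonic n.+1 - 1).
Proof.
elim: n => [|n IH].
  by rewrite /harmonic !big_ord_recl !big_ord0 /= INR_1; field.
rewrite big_ord_recr IH /= (harmonicS n.+1) (S_INR n.+1).
by field; rewrite -S_INR; exact: INR_S_neq0.
Qed.

(** Apply [ln r <= r - 1] to the fourth root [r] of [x]. *)
Lemma ln_sq_le_sqrt (x : R) : 1 <= x -> (ln x) ^ 2 <= 16 * sqrt x.
Proof.
move=> x1; set r := sqrt (sqrt x).
have s1 : 1 <= sqrt x by rewrite -sqrt_1; apply: sqrt_le_1; lra.
have r1 : 1 <= r by rewrite -sqrt_1; apply: sqrt_le_1; lra.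
have r2 : sqrt x = r ^ 2 by rewrite /r pow2_sqrt; lra.
have r4 : x = r ^ 4 by rewrite -[LHS](pow2_sqrt x); [rewrite r2; ring|lra].
have lr : ln x = 4 * ln r.
  by rewrite r4 ln_pow; [rewrite INR_IZR_INZ|lra].
have l0 : 0 <= ln r by rewrite -ln_1; apply: ln_le; lra.
have := @ln_le_sub1 r ltac:(lra) => l1.
rewrite lr r2; nra.
Qed.

Lemma sum_inv_sqrt (n : nat) : \rsum_(i < n) / sqrt (INR i.+1) <= 2 * sqrt (INR n).
Proof.
elim: n => [|n IH]; first by rewrite big_ord0 INR_0 sqrt_0; lra.
rewrite big_ord_recr /=; apply: Rle_trans (Rplus_le_compat_r _ _ _ IH) _.
set a := sqrt (INR n); set b := sqrt (INR n.+1).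
have a0 : 0 <= a := sqrt_pos _.
have b0 : 0 < b by apply: sqrt_lt_R0; exact: INR_S_gt0.
have ab : b ^ 2 = a ^ 2 + 1.
  by rewrite /a /b !pow2_sqrt ?S_INR //; have := pos_INR n; lra.
rewrite -/b.
have : / b * b = 1 by apply: Rinv_l; apply: Rgt_not_eq.
move=> ib; apply: (Rmult_le_reg_r b) => //; rewrite Rmult_plus_distr_r ib.
by have h := pow2_ge_0 (b - a); nra.
Qed.

(** Discrete form of the fact that the logarithm of a uniform variable on [[0, 1]] has a finite
    second moment. *)
Lemma sum_ln_sq_ratio (n : nat) :
  \rsum_(i < n.+1) (ln (INR n.+1 / INR i.+1)) ^ 2 <= 32 * INR n.+1.
Proof.
have N0 := INR_S_gt0 n.
apply: Rle_trans (_ : \rsum_(i < n.+1) (16 * sqrt (INR n.+1) * / sqrt (INR i.+1)) <= _).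
  apply: (@rsum_le _ (fun i => (ln (INR n.+1 / INR i.+1)) ^ 2)
            (fun i => 16 * sqrt (INR n.+1) * / sqrt (INR i.+1))) => i hi.
  have i0 := INR_S_gt0 i.
  have := @ln_sq_le_sqrt (INR n.+1 / INR i.+1); rewrite sqrt_div //; last by lra.
  rewrite Rmult_assoc; apply.
  apply: (Rmult_le_reg_r (INR i.+1)) => //.
  rewrite Rmult_1_l /Rdiv Rmult_assoc Rinv_l ?Rmult_1_r; last by lra.
  by apply: le_INR; lia.
rewrite -big_distrr /=; have := sum_inv_sqrt n.+1.
have s0 : 0 <= sqrt (INR n.+1) := sqrt_pos _.
have ss : sqrt (INR n.+1) * sqrt (INR n.+1) = INR n.+1 by apply: sqrt_sqrt; lra.
move: s0 ss; set s := sqrt _; set S := \big[Rplus/0]_(i < _) _ => s0 ss hS.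
by rewrite -ss; have := Rmult_le_compat_l _ _ _ s0 hS; lra.
Qed.

Lemma Ecyc_log_diff (n : nat) : Ecyc n (fun l => log_lengths l - log_remainders l) = 0.
Proof.
elim/ltn_ind: n => -[|n] IH; first by rewrite Ecyc0 /=; ring.
apply: (Rmult_eq_reg_l (INR n.+1)); last exact: INR_S_neq0.
rewrite EcycSm Rmult_0_r.
transitivity (\rsum_(i < n.+1) (ln (INR (n.+1 - i)%nat) + -1 * ln (INR i.+1))).
  apply: eq_bigr => i _.
  rewrite (Ecyc_ext (h := fun l => (ln (INR (n.+1 - i)%nat) - ln (INR i.+1))
                                   + (log_lengths l - log_remainders l))).
    by rewrite EcycD Ecyc_const IH //; ring.
  by move=> l sl _ /=; rewrite sl; ring.
rewrite big_split /= (rsum_rev n (fun k => ln (INR k))) -big_distrr /=.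
by ring.
Qed.

(** The first increment [d] depends on the first length only and the rest is centred, so the cross
    term vanishes. Inserting [ln (INR n.+1)] between the two logarithms in [d] and using
    [sum_ln_sq_ratio] for both gives a second moment at most [128 = 4 * 32]. By [sum_harmonic],
    adding a constant at each cycle yields that constant times [harmonic n], the mean number of
    cycles. *)
Lemma Ecyc_log_diff_sq (n : nat) :
  Ecyc n (fun l => (log_lengths l - log_remainders l) ^ 2) <= 128 * harmonic n.
Proof.
elim/ltn_ind: n => -[|n] IH; first by rewrite Ecyc0 /harmonic big_ord0 /=; lra.
have N0 := INR_S_gt0 n.
apply: (Rmult_le_reg_l (INR n.+1)) => //; rewrite EcycSm.
pose a i := ln (INR n.+1 / INR i.+1) ^ 2.
pose b i := ln (INR n.+1 / INR (n.+1 - i)%nat) ^ 2.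
apply: Rle_trans (_ : \rsum_(i < n.+1) ((2 * a i + 2 * b i) + 128 * harmonic i) <= _).
  apply: (@rsum_le _ (fun i => Ecyc i (fun l => (log_lengths ((n.+1 - i)%nat :: l)
     - log_remainders ((n.+1 - i)%nat :: l)) ^ 2))
     (fun i => ((2 * a i + 2 * b i) + 128 * harmonic i))) => i hi.
  set d := ln (INR (n.+1 - i)%nat) - ln (INR i.+1).
  rewrite (Ecyc_ext (h := fun l => (d ^ 2 + 2 * d * (log_lengths l - log_remainders l))
                                   + (log_lengths l - log_remainders l) ^ 2)); last first.
    by move=> l sl _; rewrite /d /= sl; ring.
  rewrite !EcycD EcycZ Ecyc_const Ecyc_log_diff Rmult_0_r Rplus_0_r.
  apply: Rplus_le_compat; last exact: IH.
  rewrite /a /b !ln_div //; try by apply: lt_0_INR; lia.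
  rewrite /d; set u := ln (INR (n.+1 - i)%nat); set v := ln (INR i.+1); set w := ln _.
  by have h := pow2_ge_0 ((w - v) + (w - u)); nra.
rewrite !big_split /= -!big_distrr /=.
have Sa := sum_ln_sq_ratio n.
have -> : \rsum_(i < n.+1) b i = \rsum_(i < n.+1) a i.
  by rewrite (rsum_rev n (fun k => ln (INR n.+1 / INR k) ^ 2)).
rewrite sum_harmonic; move: Sa; rewrite -/(\rsum_(i < n.+1) a i); nra.
Qed.

(** The recursion closes because the first cycle has length [k] for one value of [i], while
    [n.+1 - k] values of [i] leave room for [k], and [1 + (n + 1 - k) / k = (n + 1) / k]. *)
Lemma Ecyc_count (n k : nat) : (0 < k)%nat ->
  Ecyc n (fun l => INR (count_mem k l)) <= (if (k <= n)%nat then / INR k else 0).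
Proof.
move=> k0; have K0 : 0 < INR k by apply: lt_0_INR; lia.
have iK := Rinv_0_lt_compat _ K0.
elim/ltn_ind: n => -[|n] IH; first by rewrite Ecyc0 /= leqNgt k0 INR_0 /=; lra.
have N0 := INR_S_gt0 n.
apply: (Rmult_le_reg_l (INR n.+1)) => //; rewrite EcycSm.
apply: Rle_trans (_ : \rsum_(i < n.+1) (INR (n.+1 - i == k)%nat
                         + (if (k <= i)%nat then / INR k else 0)) <= _).
  apply: (@rsum_le _ (fun i => Ecyc i (fun l => INR (count_mem k ((n.+1 - i)%nat :: l))))
    (fun i => (INR (n.+1 - i == k)%nat + (if (k <= i)%nat then / INR k else 0)))) => i hi.
  rewrite (Ecyc_ext (h := fun l => INR (n.+1 - i == k)%nat + INR (count_mem k l))).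
    by rewrite EcycD Ecyc_const; apply: Rplus_le_compat_l; exact: IH.
  by move=> l _ _ /=; rewrite plus_INR.
case: (leqP k n.+1) => kn; last first.
  rewrite Rmult_0_r; apply: Req_le; rewrite big1 // => i _.
  have := ltn_ord i => hi; rewrite (_ : (k <= i)%nat = false); last by lia.
  by rewrite (_ : (n.+1 - i == k)%nat = false) /=; [rewrite INR_0; ring|lia].
rewrite big_split /=.
have -> : \rsum_(i < n.+1) INR (n.+1 - i == k)%nat = 1.
  have h : (n.+1 - k < n.+1)%nat by lia.
  rewrite (bigD1 (Ordinal h)) //= (_ : (n.+1 - (n.+1 - k) == k)%nat = true); last by lia.
  rewrite big1 /=; first by rewrite INR_1; ring.
  move=> i; rewrite -val_eqE /= => hi; have := ltn_ord i => hi'.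
  by rewrite (_ : (n.+1 - i == k)%nat = false) //; lia.
have e m : \rsum_(i < m) (if (k <= i)%nat then / INR k else 0) = INR (m - k)%nat * / INR k.
  elim: m => [|m IHm]; first by rewrite big_ord0 INR_0; ring.
  rewrite big_ord_recr IHm /=; case: leqP => h.
    by rewrite subSn // S_INR; ring.
  have /eqP -> : (m - k == 0)%nat by rewrite subn_eq0 ltnW.
  have /eqP -> : (m.+1 - k == 0)%nat by rewrite subn_eq0.
  by rewrite INR_0; ring.
rewrite e minus_INR; last by lia.
by apply: Req_le; field; lra.
Qed.

Lemma sum_inv_sq (n : nat) : \rsum_(i < n.+1) (/ INR i.+1) ^ 2 <= 2 - / INR n.+1.
Proof.
elim: n => [|n IH]; first by rewrite big_ord_recl big_ord0 /= INR_1; lra.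
rewrite big_ord_recr; apply: Rle_trans (Rplus_le_compat_r _ _ _ IH) _.
have a0 := INR_S_gt0 n; rewrite [nat_of_ord _]/= (S_INR n.+1); set a := INR n.+1 in a0 *.
have a1 : 0 < / (a + 1) by apply: Rinv_0_lt_compat; lra.
have e : / a - / (a + 1) = / a * / (a + 1) by field; lra.
have h : / (a + 1) <= / a by apply: Rinv_le_contravar; lra.
have h2 := Rmult_le_compat_r _ _ _ (Rlt_le _ _ a1) h.
by rewrite /= Rmult_1_r; lra.
Qed.

Lemma Ecyc_repeated (n : nat) : Ecyc n repeated_lengths <= 2.
Proof.
(* The value 0 at [n = 0] matters: the term [i = 0] then saves 2 in the average, which pays for the
   sum of [1 / k^2]. *)
suff : Ecyc n repeated_lengths <= if n is _.+1 then 2 else 0 by case: n => [|n]; lra.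
elim/ltn_ind: n => -[|n] IH; first by rewrite Ecyc0 /=; lra.
have N0 := INR_S_gt0 n.
apply: (Rmult_le_reg_l (INR n.+1)) => //; rewrite EcycSm.
pose f i := (/ INR (n.+1 - i)%nat) ^ 2; pose r i := if i is _.+1 then 2 else 0.
apply: Rle_trans (_ : \rsum_(i < n.+1) (f i + r i) <= _).
  apply: (@rsum_le _ (fun i => Ecyc i (fun l => repeated_lengths ((n.+1 - i)%nat :: l)))
    (fun i => f i + r i)) => i hi.
  set k := (n.+1 - i)%nat; have k0 : (0 < k)%nat by rewrite /k; lia.
  have K0 : 0 < INR k by apply: lt_0_INR; lia.
  rewrite (Ecyc_ext (h := fun l => / INR k * INR (count_mem k l) + repeated_lengths l)).
    rewrite EcycD EcycZ; apply: Rplus_le_compat; last exact: IH.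
    rewrite /f -/k /= Rmult_1_r; apply: Rmult_le_compat_l.
      exact: Rlt_le (Rinv_0_lt_compat _ K0).
    have iK := Rinv_0_lt_compat _ K0.
    by apply: Rle_trans (Ecyc_count i k0) _; case: ifP => _; lra.
  by move=> l _ _ /=; rewrite /Rdiv Rmult_comm.
rewrite big_split /= (rsum_rev n (fun k => (/ INR k) ^ 2)).
have h := sum_inv_sq n; have iN := Rinv_0_lt_compat _ N0.
rewrite [X in _ + X]big_ord_recl /= rsum_const S_INR.
by move: h; set S := \big[Rplus/0]_(i < _) _; lra.
Qed.

(** * Bounds on [invol] in terms of the cycle lengths *)

Lemma ffact_double_le (a j : nat) : (a ^_ (2 * j) <= Nat.pow (a * a.-1) j)%nat.
Proof.
elim: j => [|j IH]; first by rewrite muln0 ffactn0.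
rewrite mulnS addnC addn2 !ffactnSr /= multE -mulnA mulnC leq_mul //.
by apply: leq_mul; lia.
Qed.

Lemma exp_partial_le (x : R) (N : nat) : 0 <= x ->
  sum_f_R0 (fun j => / INR (j`!) * x ^ j) N <= exp x.
Proof.
move=> x0.
have fE j : j`! = Factorial.fact j by elim: j => // j IH; rewrite factS /= IH; lia.
rewrite (sum_eq _ (fun j => / INR (Factorial.fact j) * x ^ j)) => [|j _]; last by rewrite fE.
rewrite /exp; case: (exist_exp x) => l hl /=; apply: sum_incr.
  exact: hl.
move=> j; apply: Rmult_le_pos; last exact: pow_le.
by apply: Rlt_le; apply: Rinv_0_lt_compat; exact: INR_fact_lt_0.
Qed.

(** The term [j = 0] gives the lower bound. For the upper one, [(a)_{2j} <= (a (a - 1))^j] turns the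
    sum into a partial sum of the exponential series. *)
Lemma invol_factor_bounds (k a : nat) : (0 < k)%nat ->
  INR k ^ a <= invol_factor k a
    <= INR k ^ a * exp (INR a * (INR a - 1) / 2 * / INR k).
Proof.
move=> k0; have K0 : 0 < INR k by apply: lt_0_INR; lia.
rewrite /invol_factor pow_INR; set S := sum_f_R0 _ _.
have ka : 0 < INR k ^ a by apply: pow_lt.
have den j : 0 < INR ((2 * k) ^ j)%nat * INR j`!.
  rewrite pow_INR; apply: Rmult_lt_0_compat.
    by apply: pow_lt; apply: lt_0_INR; lia.
  by apply: lt_0_INR; apply/ltP; exact: fact_gt0.
have S1 : 1 <= S.
  rewrite /S; elim: (a %/ 2)%nat => [|m IH]; first by rewrite /= muln0 ffactn0 fact0 INR_1; lra.
  rewrite tech5; have h : 0 <= INR (a ^_ (2 * m.+1)) / (INR ((2 * k) ^ m.+1) * INR (m.+1)`!).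
    by apply: Rmult_le_pos; [exact: pos_INR|exact: Rlt_le (Rinv_0_lt_compat _ (den _))].
  lra.
set x := INR a * (INR a - 1) / 2 * / INR k.
have xE : x = INR (a * a.-1) / (2 * INR k).
  rewrite mult_INR /x; case: a {S S1 ka x} => [|a] /=; first by rewrite INR_0; field; lra.
  by rewrite S_INR; field; lra.
have x0 : 0 <= x.
  rewrite xE; apply: Rmult_le_pos; first exact: pos_INR.
  by apply: Rlt_le; apply: Rinv_0_lt_compat; lra.
have S2 : S <= exp x.
  apply: Rle_trans (exp_partial_le (a %/ 2) x0); apply: sum_Rle => j _.
  have e : / INR j`! * x ^ j = INR ((a * a.-1) ^ j) / (INR ((2 * k) ^ j)%nat * INR j`!).
    rewrite xE /Rdiv Rpow_mult_distr pow_inv !pow_INR (mult_INR 2 k) (_ : INR 2 = 2) //.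
    field; split; last by apply: pow_nonzero; lra.
    by apply: not_0_INR; have := fact_gt0 j; lia.
  rewrite e; apply: Rmult_le_compat_r; first exact: Rlt_le (Rinv_0_lt_compat _ (den _)).
  by apply: le_INR; apply/leP; exact: ffact_double_le.
split; nra.
Qed.

Lemma rsum_indicator (n k : nat) (f : nat -> R) : (0 < k <= n)%nat ->
  \rsum_(i < n) (INR (k == i.+1)%nat * f i.+1) = f k.
Proof.
move=> /andP [k0 kn]; have h : (k.-1 < n)%nat by lia.
rewrite (bigD1 (Ordinal h)) //= prednK // eqxx big1 /= ?INR_1; first by ring.
move=> i; rewrite -val_eqE /= => hi.
by rewrite (_ : (k == i.+1) = false) /= ?INR_0; [ring|lia].
Qed.

Lemma log_lengthsE (n : nat) (l : seq nat) :
  all (fun k => 0 < k <= n)%nat l ->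
  log_lengths l = \rsum_(i < n) (INR (count_mem i.+1 l) * ln (INR i.+1)).
Proof.
elim: l => [|k l IH] /=.
  by move=> _; rewrite big1 // => i _; rewrite INR_0; ring.
case/andP => hk hl; rewrite (IH hl) -(rsum_indicator (fun j => ln (INR j)) hk) -big_split.
by apply: eq_bigr => i _ /=; rewrite plus_INR; ring.
Qed.

Lemma repeated_lengthsE (n : nat) (l : seq nat) :
  all (fun k => 0 < k <= n)%nat l ->
  repeated_lengths l
  = \rsum_(i < n) (INR (count_mem i.+1 l) * (INR (count_mem i.+1 l) - 1) / 2 * / INR i.+1).
Proof.
elim: l => [|k l IH] /=.
  by move=> _; rewrite big1 // => i _; rewrite /= INR_0 /Rdiv !Rmult_0_l.
case/andP => hk hl.
rewrite (IH hl) -(rsum_indicator (fun j => INR (count_mem j l) / INR j) hk) -big_split.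
apply: eq_bigr => i _ /=; rewrite plus_INR.
by case: (k == i.+1); rewrite /= ?INR_1 ?INR_0; field; exact: INR_S_neq0.
Qed.

Lemma ln_prodR (n : nat) (f : nat -> R) : (forall k, (0 < k)%nat -> 0 < f k) ->
  0 < prodR_1n f n /\ ln (prodR_1n f n) = \rsum_(i < n) ln (f i.+1).
Proof.
move=> f0; elim: n => [|n [p IH]] /=; first by rewrite big_ord0 ln_1; split; [lra|].
split; first by apply: Rmult_lt_0_compat => //; exact: f0.
by rewrite big_ord_recr /= -IH ln_mult //; exact: f0.
Qed.

Lemma sumn_bound (l : seq nat) :
  all (fun k => 0 < k)%nat l -> all (fun k => 0 < k <= sumn l)%nat l.
Proof.
elim: l => //= k l IH /andP [k0 /IH al]; apply/andP; split; first by lia.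
by apply: sub_all al => j; lia.
Qed.

Lemma ln_invol_bounds (l : seq nat) : all (fun k => 0 < k)%nat l ->
  log_lengths l <= ln (invol (sumn l) (fun j => count_mem j l))
    <= log_lengths l + repeated_lengths l.
Proof.
move=> /sumn_bound; move: (sumn l) => n al.
rewrite (log_lengthsE al) (repeated_lengthsE al).
set c := fun j => count_mem j l.
have f0 k : (0 < k)%nat -> 0 < invol_factor k (c k).
  move=> k0; have [h _] := invol_factor_bounds (c k) k0.
  by apply: Rlt_le_trans h; apply: pow_lt; apply: lt_0_INR; lia.
have [_ ->] := ln_prodR n f0; rewrite -big_split /=.
have ln_pow' (i : nat) : ln (INR i.+1 ^ c i.+1) = INR (c i.+1) * ln (INR i.+1).
  by rewrite ln_pow //; exact: INR_S_gt0.
have pp i : 0 < INR i.+1 ^ c i.+1 by apply: pow_lt; exact: INR_S_gt0.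
split.
- apply: (@rsum_le _ (fun i => INR (c i.+1) * ln (INR i.+1))
           (fun i => ln (invol_factor i.+1 (c i.+1)))) => i _.
  have [h _] := invol_factor_bounds (c i.+1) (ltn0Sn i).
  by rewrite -ln_pow'; apply: ln_le.
- apply: (@rsum_le _ (fun i => ln (invol_factor i.+1 (c i.+1)))
   (fun i => INR (c i.+1) * ln (INR i.+1)
             + INR (c i.+1) * (INR (c i.+1) - 1) / 2 * / INR i.+1)) => i _.
  have [_ h] := invol_factor_bounds (c i.+1) (ltn0Sn i).
  rewrite -ln_pow' -[X in _ + X]ln_exp -ln_mult //; last exact: exp_pos.
  by apply: ln_le => //; exact: f0.
Qed.

(* Expectation of [f (\sum_j xi_j ln j)] for independent Bernoulli variables [xi_j] of parameter
   [1 / j], [1 <= j <= n]. *)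
Fixpoint Ebern (n : nat) (f : R -> R) : R :=
  if n is m.+1 then
    / INR n * Ebern m (fun a => f (a + ln (INR n))) + (1 - / INR n) * Ebern m f
  else f 0.

(** In the recursion at [n.+1], multiplied by [n.+1], the terms [i < n] are exactly those of the
    recursion at [n], and only [i = n] is new. The law at [n.+1] is therefore the law at [n], with
    [ln (INR n.+1)] added with probability [1 / (n + 1)]: one more independent Bernoulli
    variable. *)
Lemma Ecyc_log_remainders (n : nat) (f : R -> R) :
  Ecyc n (fun l => f (log_remainders l)) = Ebern n f.
Proof.
have rec m g : INR m.+1 * Ecyc m.+1 (fun l => g (log_remainders l))
    = \rsum_(i < m.+1) Ecyc i (fun l => g (log_remainders l + ln (INR i.+1))).
  rewrite EcycSm; apply: eq_bigr => i _; apply: Ecyc_ext => l sl _ /=.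
  by rewrite sl Rplus_comm.
elim: n f => [|n IH] f //=.
apply: (Rmult_eq_reg_l (INR n.+1)); last exact: INR_S_neq0.
rewrite rec big_ord_recr /= (IH (fun a => f (a + ln (INR n.+1)))) -(IH f).
have -> : \rsum_(i < n) Ecyc i (fun l => f (log_remainders l + ln (INR i.+1)))
          = INR n * Ecyc n (fun l => f (log_remainders l)).
  by case: n {IH} => [|n]; [rewrite big_ord0 INR_0; ring|rewrite rec].
have N0 := @INR_S_neq0 n; set E1 := Ebern _ _; set E2 := Ecyc _ _.
by rewrite (_ : INR n = INR n.+1 - 1); [field|rewrite S_INR; ring].
Qed.

(** * Gaussian integrals *)

Lemma exp_mono (x y : R) : x <= y -> exp x <= exp y.
Proof. by case=> [h|->]; [left; exact: exp_increasing|lra]. Qed.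

Definition gauss (t : R) : R := exp (- t ^ 2 / 2).

Definition phi (t : R) : R := gauss t / sqrt (2 * PI).

Lemma gauss_gt0 (t : R) : 0 < gauss t.
Proof. exact: exp_pos. Qed.

Lemma gauss_le1 (t : R) : gauss t <= 1.
Proof. by rewrite -exp_0; apply: exp_mono; have := pow2_ge_0 t; lra. Qed.

Lemma is_derive_gauss (t : R) : is_derive gauss t (- t * gauss t).
Proof.
rewrite /gauss; auto_derive => //; rewrite -/(exp (- t ^ 2 / 2)) (_ : INR 2 = 2) //.
by rewrite -[exp (- (t * (t * 1)) * / 2)]/(exp (- t ^ 2 / 2)); field.
Qed.

Lemma RInt_ex_derive (f : R -> R) (a b : R) : (forall t, ex_derive f t) -> ex_RInt f a b.
Proof. by move=> h; apply: ex_RInt_continuous => z _; apply: ex_derive_continuous. Qed.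

Lemma is_derive_RInt0 (f : R -> R) (x : R) : (forall t, ex_derive f t) ->
  is_derive (fun y => RInt f 0 y) x (f x).
Proof.
move=> h; apply: (@is_derive_RInt R_NormedModule f _ 0).
  by exists (mkposreal 1 Rlt_0_1) => y _; apply: RInt_correct; exact: RInt_ex_derive.
exact: ex_derive_continuous.
Qed.

Lemma ex_derive_gauss (t : R) : ex_derive gauss t.
Proof. by eexists; exact: is_derive_gauss. Qed.

Lemma Derive_gauss (t : R) : Derive (fun x => gauss x) t = - t * gauss t.
Proof. exact: is_derive_unique (is_derive_gauss t). Qed.

Definition gauss_int (x : R) : R := RInt gauss 0 x.

Lemma is_derive_gauss_int (x : R) : is_derive gauss_int x (gauss x).
Proof. exact: is_derive_RInt0 ex_derive_gauss. Qed.

(** The numerator is [2 * exp (- x^2 (1 + u^2) / 2)], so that differentiation in [x] cancels the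
    denominator. *)
Definition gauss_aux (x : R) : R := RInt (fun u => 2 * gauss x * gauss (x * u) / (1 + u ^ 2)) 0 1.

Lemma one_plus_sq_gt0 (u : R) : 0 < 1 + u ^ 2.
Proof. by have := pow2_ge_0 u; lra. Qed.

Lemma gauss_int_scale (x : R) : gauss_int x = RInt (fun u => x * gauss (x * u)) 0 1.
Proof.
rewrite /gauss_int; have := RInt_comp_lin gauss x 0 0 1.
rewrite Rmult_0_r Rmult_1_r !Rplus_0_r => <-; last exact: RInt_ex_derive ex_derive_gauss.
by apply: RInt_ext => u _; rewrite Rplus_0_r.
Qed.

Lemma is_derive_gauss_aux (x : R) :
  is_derive gauss_aux x (- 2 * gauss x * gauss_int x).
Proof.
pose g z u := - 2 * (z * (gauss z * gauss (z * u))).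
have dg z u : is_derive (fun z => 2 * gauss z * gauss (z * u) / (1 + u ^ 2)) z (g z u).
  have h := one_plus_sq_gt0 u; auto_derive.
    by split; [exact: ex_derive_gauss|split; [exact: ex_derive_gauss|]].
  by rewrite !Derive_gauss /g; field; lra.
have -> : - 2 * gauss x * gauss_int x
  = RInt (fun u => Derive (fun z => 2 * gauss z * gauss (z * u) / (1 + u ^ 2)) x) 0 1.
  rewrite (RInt_ext _ (fun u => scal (- 2 * gauss x) (x * gauss (x * u)))).
    rewrite RInt_scal ?gauss_int_scale //.
    by apply: RInt_ex_derive => t; rewrite /gauss; auto_derive.
  by move=> u _; rewrite (is_derive_unique _ _ _ (dg x u)) /g /scal /= /mult /=; ring.
apply: (@is_derive_RInt_param (fun z u => 2 * gauss z * gauss (z * u) / (1 + u ^ 2))).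
- by exists (mkposreal 1 Rlt_0_1) => z _ u _; exists (g z u).
- move=> u _; apply: (@continuity_2d_pt_ext g).
    by move=> z v; rewrite (is_derive_unique _ _ _ (dg z v)).
  have cg (h : R -> R -> R) a b : continuity_2d_pt h a b ->
      continuity_2d_pt (fun a b => gauss (h a b)) a b.
    move=> hc; apply: continuity_1d_2d_pt_comp hc.
    by apply: derivable_continuous_pt; apply/ex_derive_Reals_0/ex_derive_gauss.
  apply: continuity_2d_pt_mult; first exact: continuity_2d_pt_const.
  apply: continuity_2d_pt_mult; first exact: continuity_2d_pt_id1.
  apply: continuity_2d_pt_mult; apply: cg; first exact: continuity_2d_pt_id1.
  apply: continuity_2d_pt_mult; [exact: continuity_2d_pt_id1|exact: continuity_2d_pt_id2].
- exists (mkposreal 1 Rlt_0_1) => z _; apply: RInt_ex_derive => t; rewrite /gauss.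
  by have h := one_plus_sq_gt0 t; auto_derive; lra.
Qed.

Lemma const_of_derive0 (f : R -> R) (a b : R) : (forall x, is_derive f x 0) -> f a = f b.
Proof.
move=> h; case: (@MVT_gen f a b (fun=> 0)) => [x _|x _|c [_ e]]; first exact: h.
  by apply/continuity_pt_filterlim; apply: ex_derive_continuous; exists 0.
lra.
Qed.

(* The integral of [gauss] over the half line, from the constancy of [gauss_int ^ 2 + gauss_aux]. *)
Lemma gauss_int_sq (x : R) : gauss_int x ^ 2 + gauss_aux x = PI / 2.
Proof.
have -> : PI / 2 = gauss_int 0 ^ 2 + gauss_aux 0.
  have e : is_RInt (fun u => 2 * gauss 0 * gauss (0 * u) / (1 + u ^ 2)) 0 1
             (minus (2 * atan 1) (2 * atan 0)).
    apply: (@is_RInt_derive _ (fun u => 2 * atan u)) => u _.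
      have := is_derive_scal _ u 2 _ (is_derive_atan u).
      have -> : 2 * gauss 0 * gauss (0 * u) / (1 + u ^ 2) = scal 2 (/ (1 + u²)).
        rewrite /scal /= /mult /= /gauss Rmult_0_l (_ : - 0 ^ 2 / 2 = 0); last by field.
        by rewrite exp_0 /Rsqr; field; have := one_plus_sq_gt0 u; lra.
      by [].
    apply: ex_derive_continuous; rewrite /gauss; auto_derive.
    by have := one_plus_sq_gt0 u; lra.
  rewrite /gauss_aux (is_RInt_unique _ _ _ _ e) /gauss_int RInt_point.
  rewrite atan_1 atan_0 /zero /minus /plus /opp /=; field.
apply: (const_of_derive0 (f := fun x => gauss_int x ^ 2 + gauss_aux x)) => z.
have d1 := is_derive_gauss_int z; have d2 := is_derive_gauss_aux z.
evar_last.
  apply: is_derive_plus d2; apply: is_derive_pow d1.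
by rewrite /plus /= INR_IZR_INZ /=; ring.
Qed.

Lemma gauss_int_ge0 (x : R) : 0 <= x -> 0 <= gauss_int x.
Proof.
move=> x0; apply: RInt_ge_0 => //; first exact: RInt_ex_derive ex_derive_gauss.
by move=> t _; apply: Rlt_le; exact: gauss_gt0.
Qed.

Definition half_mass : R := sqrt (PI / 2).

Lemma half_mass_gt0 : 0 < half_mass.
Proof. by apply: sqrt_lt_R0; have := PI_RGT_0; lra. Qed.

Lemma half_mass_ge1 : 1 <= half_mass.
Proof. by rewrite -sqrt_1; apply: sqrt_le_1; have := PI2_1; lra. Qed.

Lemma sqrt_2PI : sqrt (2 * PI) = 2 * half_mass.
Proof.
have := PI_RGT_0 => p0.
rewrite /half_mass -{2}(sqrt_square 2); last by lra.
by rewrite -sqrt_mult; [congr sqrt; field|lra|lra].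
Qed.

(** By [gauss_int_sq], [half_mass^2 - gauss_int x ^ 2] is [gauss_aux x], which lies between 0 and
    [2 * gauss x]. Factor the difference of squares and use [half_mass >= 1]. *)
Lemma gauss_int_lim (x : R) : 0 <= x -> half_mass - 2 * gauss x <= gauss_int x <= half_mass.
Proof.
move=> x0; have e := gauss_int_sq x; have J0 := gauss_int_ge0 x0.
have h2 : half_mass ^ 2 = PI / 2 by rewrite /half_mass pow2_sqrt //; have := PI_RGT_0; lra.
have h1 := half_mass_ge1; have g0 := gauss_gt0 x.
have ex : ex_RInt (fun u => 2 * gauss x * gauss (x * u) / (1 + u ^ 2)) 0 1.
  apply: RInt_ex_derive => u; rewrite /gauss; have := one_plus_sq_gt0 u => h.
  by auto_derive; lra.
have a0 : 0 <= gauss_aux x.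
  apply: RInt_ge_0 => //; first by lra.
  move=> u _; apply: Rmult_le_pos; last by apply: Rlt_le; apply: Rinv_0_lt_compat; exact: one_plus_sq_gt0.
  by have := gauss_gt0 (x * u); nra.
have a1 : gauss_aux x <= 2 * gauss x.
  have -> : 2 * gauss x = RInt (fun=> 2 * gauss x) 0 1.
    by rewrite RInt_const /scal /= /mult /=; ring.
  apply: RInt_le => //; [lra|exact: ex_RInt_const|move=> u _].
  have h := gauss_le1 (x * u); have h' := gauss_gt0 (x * u).
  have i0 : 0 < / (1 + u ^ 2) by apply: Rinv_0_lt_compat; exact: one_plus_sq_gt0.
  have i1 : / (1 + u ^ 2) <= 1.
    by rewrite -Rinv_1; apply: Rinv_le_contravar; have := pow2_ge_0 u; lra.
  rewrite /Rdiv Rmult_assoc -[X in _ <= X]Rmult_1_r; apply: Rmult_le_compat_l; first by lra.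
  by have h3 := Rmult_le_compat_r _ _ _ (Rlt_le _ _ i0) h; lra.
split; last by nra.
have f : (half_mass - gauss_int x) * (half_mass + gauss_int x) = gauss_aux x by nra.
case: (Rle_lt_dec half_mass (gauss_int x)) => d; first by lra.
have : (half_mass - gauss_int x) * 1 <= (half_mass - gauss_int x) * (half_mass + gauss_int x).
  by apply: Rmult_le_compat_l; lra.
lra.
Qed.

Lemma exp_ge_pow (k : nat) (x : R) : 0 <= x -> x ^ k.+1 <= INR k.+1 ^ k.+1 * exp x.
Proof.
move=> x0; have K0 := INR_S_gt0 k.
have e : exp x = exp (x / INR k.+1) ^ k.+1.
  by rewrite -exp_INR_mul; congr exp; field; lra.
have -> : x ^ k.+1 = INR k.+1 ^ k.+1 * (x / INR k.+1) ^ k.+1.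
  by rewrite -Rpow_mult_distr; congr pow; field; lra.
rewrite e; apply: Rmult_le_compat_l; first by apply: pow_le; lra.
apply: pow_incr; split.
  by apply: Rmult_le_pos => //; apply: Rlt_le; apply: Rinv_0_lt_compat.
have := exp_ineq1_le (x / INR k.+1); lra.
Qed.

Lemma gauss_opp (t : R) : gauss (- t) = gauss t.
Proof. by rewrite /gauss; congr exp; field. Qed.

Lemma gauss_le_inv_sq (t : R) : t ^ 2 * gauss t <= 2.
Proof.
have e : gauss t * exp (t ^ 2 / 2) = 1.
  by rewrite /gauss -exp_plus -exp_0; congr exp; field.
have h := exp_ineq1_le (t ^ 2 / 2); have g := gauss_gt0 t.
have := Rmult_le_compat_l _ _ _ (Rlt_le _ _ g) h; lra.
Qed.

Lemma gauss_pow4 (t : R) : t ^ 4 * gauss t <= 16.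
Proof.
have e : gauss t * exp (t ^ 2 / 2) = 1.
  by rewrite /gauss -exp_plus -exp_0; congr exp; field.
have h := @exp_ge_pow 1 (t ^ 2 / 2) ltac:(have := pow2_ge_0 t; lra).
rewrite (_ : INR 2 = 2) // in h; have g := gauss_gt0 t.
have := Rmult_le_compat_l _ _ _ (Rlt_le _ _ g) h; nra.
Qed.

(** * Fourier integrals of the Gaussian *)

Lemma is_lim_inv_bound (h : R -> R) (l M : R) :
  (forall T, 1 <= T -> Rabs (h T - l) <= M / T) -> is_lim h p_infty l.
Proof.
move=> H; have M0 : 0 <= M.
  by have := H 1 (Rle_refl 1); have := Rabs_pos (h 1 - l); lra.
apply/is_lim_spec => eps; exists (Rmax 1 (M / eps)) => T hT.
have e0 := cond_pos eps.
have T1 : 1 < T by apply: Rle_lt_trans hT; exact: Rmax_l.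
have T2 : M / eps < T by apply: Rle_lt_trans hT; exact: Rmax_r.
apply: Rle_lt_trans (H T _) _; first by lra.
apply: (Rmult_lt_reg_r (T / eps)); first by apply: Rdiv_lt_0_compat; lra.
have -> : M / T * (T / eps) = M / eps by field; lra.
by have -> : eps * (T / eps) = T by field; lra.
Qed.

Definition cos_gauss (T u : R) : R := RInt (fun t => cos (t * u) * gauss t) 0 T.

Lemma ex_derive_cos_gauss (u t : R) : ex_derive (fun t => cos (t * u) * gauss t) t.
Proof. by rewrite /gauss; auto_derive. Qed.

(** Differentiating under the integral brings out [- t * gauss t], the derivative of [gauss].
    Integration by parts then gives the equation [F' = - u F] of the Gaussian, up to a boundary term
    at [T]. *)
Lemma is_derive_cos_gauss (T u : R) :
  is_derive (cos_gauss T) u (gauss T * sin (T * u) - u * cos_gauss T u).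
Proof.
pose g v t := - (t * (sin (t * v) * gauss t)).
have dg v t : is_derive (fun v => cos (t * v) * gauss t) v (g v t).
  by auto_derive => //; rewrite /g; ring.
have -> : gauss T * sin (T * u) - u * cos_gauss T u
  = RInt (fun t => Derive (fun v => cos (t * v) * gauss t) u) 0 T.
  rewrite (RInt_ext _ (fun t => minus (g u t + u * (cos (t * u) * gauss t))
                                      (scal u (cos (t * u) * gauss t)))); last first.
    move=> t _; rewrite (is_derive_unique _ _ _ (dg u t)).
    by rewrite /minus /plus /opp /scal /= /mult /=; ring.
  have e : is_RInt (fun t => g u t + u * (cos (t * u) * gauss t)) 0 T
             (minus (gauss T * sin (T * u)) (gauss 0 * sin (0 * u))).
    apply: (@is_RInt_derive _ (fun t => gauss t * sin (t * u))) => t _.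
      by auto_derive; [exact: ex_derive_gauss|rewrite Derive_gauss /g; ring].
    by apply: ex_derive_continuous; rewrite /g /gauss; auto_derive.
  rewrite RInt_minus; last 2 first.
  - by eexists; exact: e.
  - by apply: RInt_ex_derive => t; rewrite /scal /= /mult /= /gauss; auto_derive.
  rewrite (is_RInt_unique _ _ _ _ e) RInt_scal; last exact: RInt_ex_derive (ex_derive_cos_gauss u).
  by rewrite Rmult_0_l sin_0 /minus /plus /opp /scal /= /mult /= /cos_gauss; ring.
apply: (@is_derive_RInt_param (fun v t => cos (t * v) * gauss t)).
- by exists (mkposreal 1 Rlt_0_1) => v _ t _; exists (g v t).
- move=> t _; apply: (@continuity_2d_pt_ext g).
    by move=> v s; rewrite (is_derive_unique _ _ _ (dg v s)).
  apply: continuity_2d_pt_opp; apply: continuity_2d_pt_mult; first exact: continuity_2d_pt_id2.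
  apply: continuity_2d_pt_mult; last first.
    apply: (continuity_1d_2d_pt_comp gauss); last exact: continuity_2d_pt_id2.
    by apply: derivable_continuous_pt; apply/ex_derive_Reals_0/ex_derive_gauss.
  apply: (continuity_1d_2d_pt_comp sin); first exact: continuity_sin.
  apply: continuity_2d_pt_mult; [exact: continuity_2d_pt_id2|exact: continuity_2d_pt_id1].
- by exists (mkposreal 1 Rlt_0_1) => v _; apply: RInt_ex_derive; exact: ex_derive_cos_gauss.
Qed.

Lemma Rabs_le_MVT (f df : R -> R) (a b M : R) :
  (forall x, Rmin a b <= x <= Rmax a b -> is_derive f x (df x)) ->
  (forall x, Rmin a b <= x <= Rmax a b -> Rabs (df x) <= M) ->
  Rabs (f b - f a) <= M * Rabs (b - a).
Proof.
move=> d m; case: (@MVT_gen f a b df) => [x hx|x hx|c [hc ->]].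
- by apply: d; lra.
- by apply/continuity_pt_filterlim; apply: ex_derive_continuous; exists (df x); apply: d.
- by rewrite Rabs_mult; apply: Rmult_le_compat_r; [exact: Rabs_pos|exact: m].
Qed.

(** With the integrating factor [E], only the boundary term survives in the derivative of
    [cos_gauss T v * E v]. Compare the values at [u] and at 0, where it equals [gauss_int T]. *)
Lemma cos_gauss_approx (T u : R) : 0 <= T ->
  Rabs (cos_gauss T u - half_mass * gauss u) <= (Rabs u + 2) * gauss T.
Proof.
move=> T0; pose E v := exp (v ^ 2 / 2).
have gE : gauss u * E u = 1.
  by rewrite /gauss /E -exp_plus -exp_0; congr exp; field.
have gu := gauss_gt0 u; have gT := gauss_gt0 T.
have dE v : is_derive E v (v * E v).
  rewrite /E; auto_derive => //.
  by rewrite (_ : INR 2 = 2) // -[v * (v * 1)]/(v ^ 2) -/(v ^ 2 / 2); field.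
have h1 : Rabs (cos_gauss T u * E u - cos_gauss T 0 * E 0) <= gauss T * E u * Rabs (u - 0).
  apply: (@Rabs_le_MVT (fun v => cos_gauss T v * E v) (fun v => gauss T * sin (T * v) * E v)).
    move=> v _; evar_last.
      by apply: is_derive_mult (is_derive_cos_gauss T v) (dE v) _; exact: Rmult_comm.
    by rewrite /plus /mult /=; ring.
  move=> v hv; rewrite !Rabs_mult (Rabs_pos_eq (gauss T)); last by lra.
  have v2 : v ^ 2 <= u ^ 2.
    by move: hv; rewrite /Rmin /Rmax; case: Rle_dec => h0 [h1 h2]; nra.
  have Ev : E v <= E u by apply: exp_mono; lra.
  have E0 : 0 < E v by exact: exp_pos.
  rewrite (Rabs_pos_eq (E v)); last by lra.
  rewrite -[X in _ <= X * _]Rmult_1_r; apply: Rmult_le_compat => //; try lra.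
    by apply: Rmult_le_pos; [lra|exact: Rabs_pos].
  by apply: Rmult_le_compat_l; [lra|apply/Rabs_le; have := SIN_bound (T * v); lra].
have c0 : cos_gauss T 0 * E 0 = gauss_int T.
  rewrite /E (_ : 0 ^ 2 / 2 = 0) ?exp_0 ?Rmult_1_r; last by field.
  by apply: RInt_ext => t _; rewrite Rmult_0_r cos_0 Rmult_1_l.
have [j1 j2] := gauss_int_lim T0.
rewrite c0 Rminus_0_r in h1.
have -> : cos_gauss T u - half_mass * gauss u
  = gauss u * (cos_gauss T u * E u - gauss_int T + (gauss_int T - half_mass)).
  transitivity (cos_gauss T u * (gauss u * E u) - half_mass * gauss u); last by ring.
  by rewrite gE; ring.
rewrite Rabs_mult (Rabs_pos_eq (gauss u)); last by lra.
apply: Rle_trans (_ : gauss u * (gauss T * E u * Rabs u + 2 * gauss T) <= _).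
  apply: Rmult_le_compat_l; first by lra.
  apply: Rle_trans (Rabs_triang _ _) _; apply: Rplus_le_compat => //.
  by apply/Rabs_le; lra.
have -> : gauss u * (gauss T * E u * Rabs u + 2 * gauss T)
  = gauss T * Rabs u * (gauss u * E u) + 2 * gauss T * gauss u by ring.
rewrite gE; have := Rmult_le_compat_l _ _ _ (Rlt_le _ _ gT) (gauss_le1 u); lra.
Qed.

Lemma gauss_le_div (T : R) : 1 <= T -> gauss T <= 16 / T.
Proof.
move=> T1; have h := gauss_pow4 T; have g := gauss_gt0 T.
apply: (Rmult_le_reg_r T); first by lra.
have -> : 16 / T * T = 16 by field; lra.
apply: Rle_trans h; rewrite Rmult_comm; apply: Rmult_le_compat_r; first by lra.
by rewrite -{1}(pow_1 T); apply: Rle_pow; [|lia].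
Qed.

Lemma is_lim_cos_gauss (u : R) :
  is_lim (fun T => cos_gauss T u) p_infty (half_mass * gauss u).
Proof.
apply: (@is_lim_inv_bound _ _ ((Rabs u + 2) * 16)) => T T1.
apply: Rle_trans (cos_gauss_approx u _) _; first by lra.
rewrite /Rdiv Rmult_assoc; apply: Rmult_le_compat_l; first by have := Rabs_pos u; lra.
exact: gauss_le_div.
Qed.

Lemma is_lim_cos_gauss_scale (e u : R) : 0 < e ->
  is_lim (fun T => RInt (fun t => cos (t * u) * gauss (e * t)) 0 T) p_infty
    (half_mass * gauss (u / e) / e).
Proof.
move=> e0.
have E T : RInt (fun t => cos (t * u) * gauss (e * t)) 0 T = cos_gauss (e * T) (u / e) / e.
  have := RInt_comp_lin (fun t => cos (t * (u / e)) * gauss t) e 0 0 T.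
  rewrite Rmult_0_r !Rplus_0_r /cos_gauss => <-; last exact: RInt_ex_derive (ex_derive_cos_gauss _).
  rewrite RInt_scal; last first.
    by apply: RInt_ex_derive => t; rewrite /gauss; auto_derive.
  rewrite /scal /= /mult /=.
  have -> : forall x, e * x / e = x by move=> x; field; lra.
  apply: RInt_ext => t _; rewrite Rplus_0_r; congr (cos _ * _); field; lra.
apply: (is_lim_ext (fun T => cos_gauss (e * T) (u / e) / e)) => [T|]; first by rewrite E.
apply: (@is_lim_inv_bound _ _ ((Rabs (u / e) + 2) * (2 / e ^ 2) / e)) => T T1.
have -> : cos_gauss (e * T) (u / e) / e - half_mass * gauss (u / e) / e
  = (cos_gauss (e * T) (u / e) - half_mass * gauss (u / e)) / e by field; lra.
rewrite Rabs_div; last by lra.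
rewrite (Rabs_pos_eq e); last by lra.
have eT : 0 < e * T by apply: Rmult_lt_0_compat; lra.
have := cos_gauss_approx (u / e) (Rlt_le _ _ eT).
have g2 := gauss_le_inv_sq (e * T); have g0 := gauss_gt0 (e * T).
have g3 : gauss (e * T) <= 2 / e ^ 2 / T.
  apply: (Rmult_le_reg_l (e ^ 2 * T)); first by apply: Rmult_lt_0_compat; [exact: pow_lt|lra].
  have -> : e ^ 2 * T * (2 / e ^ 2 / T) = 2 by field; split; lra.
  have e2 : 0 < e ^ 2 by apply: pow_lt.
  apply: Rle_trans g2; apply: Rmult_le_compat_r; first by lra.
  by rewrite Rpow_mult_distr; apply: Rmult_le_compat_l; nra.
move=> h; have ie := Rinv_0_lt_compat _ e0.
have -> : (Rabs (u / e) + 2) * (2 / e ^ 2) / e / T = (Rabs (u / e) + 2) * (2 / e ^ 2 / T) / e.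
  by field; lra.
apply: Rmult_le_compat_r; first by lra.
apply: Rle_trans h _; apply: Rmult_le_compat_l => //.
by have := Rabs_pos (u / e); lra.
Qed.

Lemma is_lim_sin3_gauss (u : R) :
  is_lim (fun T => RInt (fun t => t ^ 3 * sin (t * u) * gauss t) 0 T) p_infty
    ((3 * u - u ^ 3) * (half_mass * gauss u)).
Proof.
(* The derivative of [A] is the integrand minus [(3 * u - u ^ 3) * (cos (t * u) * gauss t)], and [A]
   vanishes at 0 and at infinity. The cubic comes from the third derivative of the Gaussian in
   [u]. *)
pose A t := gauss t * (- (t ^ 2 + 2 - u ^ 2) * sin (t * u) - u * t * cos (t * u)).
have E T : RInt (fun t => t ^ 3 * sin (t * u) * gauss t) 0 T
           = (3 * u - u ^ 3) * cos_gauss T u + A T.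
  rewrite (RInt_ext _ (fun t => plus (scal (3 * u - u ^ 3) (cos (t * u) * gauss t))
     (t ^ 3 * sin (t * u) * gauss t - (3 * u - u ^ 3) * (cos (t * u) * gauss t)))); last first.
    by move=> t _; rewrite /plus /scal /= /mult /=; ring.
  have e : is_RInt (fun t => t ^ 3 * sin (t * u) * gauss t
                             - (3 * u - u ^ 3) * (cos (t * u) * gauss t)) 0 T
             (minus (A T) (A 0)).
    apply: is_RInt_derive => t _.
      rewrite /A; auto_derive; first by repeat split; exact: ex_derive_gauss.
      by rewrite Derive_gauss (_ : INR 2 = 2) //; ring.
    by apply: ex_derive_continuous; rewrite /gauss; auto_derive.
  rewrite RInt_plus; last 2 first.
  - by apply: RInt_ex_derive => t; rewrite /scal /= /mult /= /gauss; auto_derive.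
  - by eexists; exact: e.
  rewrite (is_RInt_unique _ _ _ _ e) RInt_scal; last exact: RInt_ex_derive (ex_derive_cos_gauss u).
  rewrite /A Rmult_0_l sin_0 /minus /plus /opp /scal /= /mult /= /cos_gauss; ring.
apply: (is_lim_ext (fun T => (3 * u - u ^ 3) * cos_gauss T u + A T)) => [T|]; first by rewrite E.
rewrite -[X in is_lim _ _ (Finite X)]Rplus_0_r.
apply: is_lim_plus'; first by have := is_lim_scal_l _ (3 * u - u ^ 3) _ _ (@is_lim_cos_gauss u).
apply: (@is_lim_inv_bound _ _ ((3 + u ^ 2 + Rabs u) * 16)) => T T1; rewrite Rminus_0_r /A.
have h := gauss_pow4 T; have g := gauss_gt0 T.
rewrite Rabs_mult (Rabs_pos_eq (gauss T)); last by lra.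
have u2 := pow2_ge_0 u; have ua := Rabs_pos u.
have T2 : T <= T ^ 2 by nra.
have b : Rabs (- (T ^ 2 + 2 - u ^ 2) * sin (T * u) - u * T * cos (T * u))
         <= (3 + u ^ 2 + Rabs u) * T ^ 3.
  have s1 : Rabs (sin (T * u)) <= 1 by apply/Rabs_le; have := SIN_bound (T * u); lra.
  have c1 : Rabs (cos (T * u)) <= 1 by apply/Rabs_le; have := COS_bound (T * u); lra.
  apply: Rle_trans (Rabs_triang _ _) _; rewrite Rabs_Ropp !Rabs_mult Rabs_Ropp (Rabs_pos_eq T); last by lra.
  have m : Rabs (T ^ 2 + 2 - u ^ 2) <= T ^ 2 + 2 + u ^ 2 by apply/Rabs_le; nra.
  have m1 : Rabs (T ^ 2 + 2 - u ^ 2) * Rabs (sin (T * u)) <= (T ^ 2 + 2 + u ^ 2) * 1.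
    by apply: Rmult_le_compat; try exact: Rabs_pos.
  have m2 : Rabs u * T * Rabs (cos (T * u)) <= Rabs u * T * 1.
    by apply: Rmult_le_compat_l => //; nra.
  have T3 : T ^ 2 <= T ^ 3 by nra.
  have : (2 + u ^ 2) * 1 <= (2 + u ^ 2) * T ^ 3 by apply: Rmult_le_compat_l; nra.
  have : Rabs u * T <= Rabs u * T ^ 3 by apply: Rmult_le_compat_l; lra.
  lra.
apply: (Rmult_le_reg_r T); first by lra.
have -> : (3 + u ^ 2 + Rabs u) * 16 / T * T = (3 + u ^ 2 + Rabs u) * 16 by field; lra.
apply: Rle_trans (_ : (3 + u ^ 2 + Rabs u) * (T ^ 4 * gauss T) <= _); last first.
  by apply: Rmult_le_compat_l; lra.
have := Rmult_le_compat_l (gauss T * T) _ _ ltac:(nra) b; lra.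
Qed.

(** * The normal distribution function *)

Lemma phiE (x : R) : phi x = gauss x / (2 * half_mass).
Proof. by rewrite /phi sqrt_2PI. Qed.

Lemma gauss_int_opp (x : R) : gauss_int (- x) = - gauss_int x.
Proof.
suff : gauss_int x + gauss_int (- x) = 0 by lra.
have -> : 0 = gauss_int 0 + gauss_int (- 0).
  by rewrite Ropp_0 /gauss_int RInt_point /zero /=; ring.
apply: (const_of_derive0 (f := fun x => gauss_int x + gauss_int (- x))) => z.
have d (t : R) := is_derive_gauss_int t.
have e t : Derive (fun x => gauss_int x) t = gauss t by exact: is_derive_unique (d t).
auto_derive; first by split; [exists (gauss z)|split; [exists (gauss (- z))|]].
by rewrite !e gauss_opp; ring.
Qed.

Lemma PhiE (x : R) : Phi x = / 2 + gauss_int x / (2 * half_mass).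
Proof.
have h0 := half_mass_gt0.
suff H : is_RInt_gen (fun t => exp (- t ^ 2 / 2) / sqrt (2 * PI)) (Rbar_locally m_infty)
           (at_point x) (/ 2 + gauss_int x / (2 * half_mass)).
  have e := @is_RInt_gen_unique R_CompleteNormedModule (Rbar_locally m_infty) (at_point x) _ _ _ _ H.
  exact: e.
move=> P [eps Peps].
have h1 := half_mass_ge1.
have e0 := cond_pos eps.
have ii a : is_RInt (fun t => exp (- t ^ 2 / 2) / sqrt (2 * PI)) a x
              ((gauss_int x - gauss_int a) / (2 * half_mass)).
  have -> : (gauss_int x - gauss_int a) / (2 * half_mass)
            = minus (gauss_int x / (2 * half_mass)) (gauss_int a / (2 * half_mass)).
    by rewrite /minus /plus /opp /=; field; lra.
  apply: (@is_RInt_derive _ (fun t => gauss_int t / (2 * half_mass))) => t _.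
    have d : Derive (fun x => gauss_int x) t = gauss t by exact: is_derive_unique (is_derive_gauss_int t).
    auto_derive; first by exists (gauss t); exact: is_derive_gauss_int.
    by rewrite d sqrt_2PI /gauss; field; lra.
  by apply: ex_derive_continuous; auto_derive.
rewrite /filtermapi; apply: (@Filter_prod _ _ _ _ _ (fun a => a < - (Rmax 1 (16 / eps) + 1)) (fun b => b = x)).
- by exists (- (Rmax 1 (16 / eps) + 1)).
- by [].
move=> a b /= ha ->; exists ((gauss_int x - gauss_int a) / (2 * half_mass)); split; first exact: ii.
apply: Peps; rewrite /ball /= /AbsRing_ball /abs /minus /plus /opp /=.
have m1 := Rmax_l 1 (16 / eps); have m2 := Rmax_r 1 (16 / eps).
have a0 : 0 <= - a by lra.
have [j1 j2] := gauss_int_lim a0; rewrite gauss_int_opp in j1 j2.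
have -> : (gauss_int x - gauss_int a) / (2 * half_mass)
          + - (/ 2 + gauss_int x / (2 * half_mass))
        = - ((half_mass + gauss_int a) / (2 * half_mass)) by field; lra.
rewrite Rabs_Ropp Rabs_pos_eq; last first.
  by apply: Rmult_le_pos; [lra|apply: Rlt_le; apply: Rinv_0_lt_compat; lra].
apply: (Rmult_lt_reg_r (2 * half_mass)); first by lra.
have -> : (half_mass + gauss_int a) / (2 * half_mass) * (2 * half_mass) = half_mass + gauss_int a.
  by field; lra.
have g : gauss (- a) < eps.
  apply: Rle_lt_trans (gauss_le_div _) _; first by lra.
  apply: (Rmult_lt_reg_r (- a / eps)); first by apply: Rdiv_lt_0_compat; lra.
  have -> : 16 / - a * (- a / eps) = 16 / eps by field; lra.
  have -> : eps * (- a / eps) = - a by field; lra.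
  lra.
by have := Rmult_le_compat_l (2 * eps) _ _ ltac:(lra) h1; lra.
Qed.

Lemma is_derive_Phi (x : R) : is_derive Phi x (phi x).
Proof.
apply: (is_derive_ext (fun x => / 2 + gauss_int x / (2 * half_mass))) => [t|].
  by rewrite PhiE.
have e : Derive (fun x => gauss_int x) x = gauss x by exact: is_derive_unique (is_derive_gauss_int x).
have h := half_mass_gt0.
auto_derive; first by exists (gauss x); exact: is_derive_gauss_int.
by rewrite e phiE; field; lra.
Qed.

Lemma phi_ge0 (x : R) : 0 <= phi x.
Proof.
by rewrite phiE; apply: Rlt_le; apply: Rdiv_lt_0_compat; [exact: gauss_gt0|have := half_mass_gt0; lra].
Qed.

Lemma phi_le_gauss (x : R) : phi x <= gauss x.
Proof.
rewrite phiE -[X in _ <= X]Rmult_1_r; apply: Rmult_le_compat_l; first exact: Rlt_le (gauss_gt0 x).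
by rewrite -Rinv_1; apply: Rinv_le_contravar; have := half_mass_ge1; lra.
Qed.

Lemma Phi_opp (x : R) : Phi (- x) = 1 - Phi x.
Proof. by rewrite !PhiE gauss_int_opp; field; have := half_mass_gt0; lra. Qed.

Lemma Phi_le (x y : R) : x <= y -> Phi x <= Phi y.
Proof.
move=> xy; case: (@MVT_gen Phi x y phi) => [z _|z _|c [_ e]].
- exact: is_derive_Phi.
- by apply/continuity_pt_filterlim; apply: ex_derive_continuous; exists (phi z); exact: is_derive_Phi.
- by have := Rmult_le_pos _ _ (phi_ge0 c) (_ : 0 <= y - x); lra.
Qed.

(** Quadratic decay suffices: the bound is used at [v = L^{1/3}], where all the other errors are of
    order [L^{-2/3}] as well. *)
Lemma Phi_tail (v : R) : 0 < v -> Phi (- v) <= 2 / v ^ 2.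
Proof.
move=> v0; have [j1 j2] := gauss_int_lim (Rlt_le _ _ v0).
have h1 := half_mass_ge1; have v2 : 0 < v ^ 2 by apply: pow_lt.
have g2 := gauss_le_inv_sq v.
have g3 : gauss v <= 2 / v ^ 2.
  apply: (Rmult_le_reg_l (v ^ 2)) => //; apply: Rle_trans g2 _.
  by apply: Req_le; field; lra.
apply: Rle_trans g3; rewrite Phi_opp PhiE.
have -> : 1 - (/ 2 + gauss_int v / (2 * half_mass)) = (half_mass - gauss_int v) / (2 * half_mass).
  by field; lra.
apply: (Rmult_le_reg_r (2 * half_mass)); first by lra.
have -> : (half_mass - gauss_int v) / (2 * half_mass) * (2 * half_mass) = half_mass - gauss_int v.
  by field; lra.
have g := gauss_gt0 v; have := Rmult_le_compat_l _ _ _ (Rlt_le _ _ g) h1; lra.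
Qed.

Lemma Phi_ge0 (x : R) : 0 <= Phi x.
Proof.
have h1 := half_mass_gt0; rewrite PhiE.
have -> : / 2 + gauss_int x / (2 * half_mass) = (half_mass + gauss_int x) / (2 * half_mass).
  by field; lra.
apply: Rmult_le_pos; last by apply: Rlt_le; apply: Rinv_0_lt_compat; lra.
case: (Rle_lt_dec 0 x) => x0; first by have := gauss_int_ge0 x0; lra.
have x1 : 0 <= - x by lra.
by have [_] := gauss_int_lim x1; rewrite gauss_int_opp; lra.
Qed.

Lemma Phi_le1 (x : R) : Phi x <= 1.
Proof. by have := Phi_ge0 (- x); rewrite Phi_opp; lra. Qed.

(** * The characteristic function *)

Section Complex_C.
Local Open Scope C_scope.

Definition cis (y : R) : C := (cos y, sin y).

Definition cexp (z : C) : C := (exp (Re z) * cos (Im z), exp (Re z) * sin (Im z))%R.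

Lemma C_eq (z w : C) : Re z = Re w -> Im z = Im w -> z = w.
Proof. by case: z => a b; case: w => c d /= -> ->. Qed.

Lemma cexp_add (z w : C) : cexp (z + w) = cexp z * cexp w.
Proof.
case: z => a b; case: w => c d.
by apply: C_eq; rewrite /= exp_plus ?cos_plus ?sin_plus; ring.
Qed.

Lemma cexp0 : cexp 0 = 1.
Proof. by apply: C_eq; rewrite /= exp_0 ?cos_0 ?sin_0; ring. Qed.

Lemma cexp_opp (z : C) : cexp z * cexp (- z) = 1.
Proof. by rewrite -cexp_add -cexp0; congr cexp; ring. Qed.

Lemma cexp_imag (y : R) : cexp (0, y) = cis y.
Proof. by apply: C_eq; rewrite /= exp_0; ring. Qed.

Lemma cexp_real (x : R) : cexp (RtoC x) = RtoC (exp x).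
Proof. by apply: C_eq; rewrite /= ?cos_0 ?sin_0; ring. Qed.

Lemma cis_add (x y : R) : cis (x + y) = cis x * cis y.
Proof. by apply: C_eq; rewrite /= ?cos_plus ?sin_plus; ring. Qed.

Lemma Cmod_cexp (z : C) : Cmod (cexp z) = exp (Re z).
Proof.
rewrite /Cmod /= -[RHS]sqrt_Rsqr; last exact: Rlt_le (exp_pos _).
congr sqrt; have := sin2_cos2 (Im z); rewrite /Rsqr => e.
set E := exp _; transitivity (E * E * (sin (Im z) * sin (Im z) + cos (Im z) * cos (Im z)))%R.
  by ring.
by rewrite e; ring.
Qed.

Lemma Cmod_cis (y : R) : Cmod (cis y) = 1%R.
Proof. by rewrite -cexp_imag Cmod_cexp exp_0. Qed.

Lemma Cmod_le_Rabs (z : C) : (Cmod z <= Rabs (Re z) + Rabs (Im z))%R.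
Proof.
rewrite {1}(_ : z = RtoC (Re z) + Ci * RtoC (Im z)); last first.
  by case: z => a b; apply: C_eq => /=; ring.
by apply: Rle_trans (Cmod_triangle _ _) _; rewrite Cmod_mult !Cmod_R Cmod_Ci; lra.
Qed.

Lemma Cmod_cis_sub1 (y : R) : (Cmod (cis y - 1) <= 2 * Rabs y)%R.
Proof.
have d (f df : R -> R) : (forall x, is_derive f x (df x)) -> (forall x, Rabs (df x) <= 1)%R ->
    (Rabs (f y - f 0) <= Rabs y)%R.
  move=> hf hd; have := @Rabs_le_MVT f df 0 y 1 (fun x _ => hf x) (fun x _ => hd x).
  by rewrite Rminus_0_r Rmult_1_l.
have c := d cos (fun x => - sin x)%R _ _; have s := d sin cos _ _.
apply: Rle_trans (Cmod_le_Rabs _) _ => /=.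
have h1 : (Rabs (cos y - cos 0) <= Rabs y)%R.
  by apply: c => x; [auto_derive => //; ring|rewrite Rabs_Ropp; apply/Rabs_le; have := SIN_bound x; lra].
have h2 : (Rabs (sin y - sin 0) <= Rabs y)%R.
  by apply: s => x; [auto_derive => //; ring|apply/Rabs_le; have := COS_bound x; lra].
by rewrite cos_0 in h1; rewrite sin_0 in h2; move: h1 h2; rewrite /Rminus !Ropp_0; lra.
Qed.

Lemma taylor2_bound (f f1 f2 : R -> R) (M : R) :
  (forall s, is_derive f s (f1 s)) -> (forall s, is_derive f1 s (f2 s)) ->
  (forall s, 0 <= s <= 1 -> Rabs (f2 s) <= M)%R ->
  (Rabs (f 1 - f 0 - f1 0) <= M)%R.
Proof.
move=> d1 d2 b.
have M0 : (0 <= M)%R by apply: Rle_trans (b 0%R _); [exact: Rabs_pos|lra].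
have h : (Rabs ((f 1 - f1 0 * 1) - (f 0 - f1 0 * 0)) <= M * Rabs (1 - 0))%R.
  apply: (@Rabs_le_MVT (fun s => f s - f1 0 * s)%R (fun s => f1 s - f1 0)%R).
    move=> s _; auto_derive; first by exists (f1 s).
    by rewrite (is_derive_unique _ _ _ (d1 s)); ring.
  rewrite Rmin_left ?Rmax_right; try lra; move=> s hs.
  apply: Rle_trans (@Rabs_le_MVT f1 f2 0 s M _ _) _ => //.
    by rewrite Rmin_left ?Rmax_right; try lra; move=> x hx; apply: b; lra.
  rewrite Rminus_0_r Rabs_pos_eq; last by lra.
  by rewrite -[X in (_ <= X)%R]Rmult_1_r; apply: Rmult_le_compat_l; lra.
move: h.
have -> : (f 1 - f1 0 * 1 - (f 0 - f1 0 * 0) = f 1 - f 0 - f1 0)%R by ring.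
by rewrite Rminus_0_r Rabs_R1 Rmult_1_r.
Qed.

(** Taylor expansion along the segment from 0 to [z], separately for the real and imaginary parts.
    The factor [exp (Rmax 0 (Re z))] bounds the modulus of [cexp] on that segment. *)
Lemma cexp_taylor (z : C) :
  (Cmod (cexp z - 1 - z) <= 4 * Cmod z ^ 2 * exp (Rmax 0 (Re z)))%R.
Proof.
case: z => a b; set M := exp (Rmax 0 a).
have mE : (Cmod (a, b) ^ 2 = a ^ 2 + b ^ 2)%R.
  by rewrite /Cmod pow2_sqrt //=; nra.
have bd s p : (0 <= s <= 1)%R -> (Rabs p <= 2 * (a ^ 2 + b ^ 2))%R ->
    (Rabs (exp (a * s) * p) <= 2 * (a ^ 2 + b ^ 2) * M)%R.
  move=> hs hp; rewrite Rabs_mult Rabs_pos_eq; last exact: Rlt_le (exp_pos _).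
  rewrite Rmult_comm; apply: Rmult_le_compat => //; first exact: Rabs_pos.
    exact: Rlt_le (exp_pos _).
  apply: exp_mono; case: (Rle_lt_dec 0 a) => a0.
    by rewrite Rmax_right //; nra.
  by rewrite Rmax_left; nra.
have tb c s u v : (u * u + v * v = 1)%R -> c = a -> s = b ->
    (Rabs ((c ^ 2 - s ^ 2) * u - 2 * c * s * v) <= 2 * (a ^ 2 + b ^ 2))%R.
  move=> e -> ->; have hu : (-1 <= u <= 1)%R by nra.
  have hv : (-1 <= v <= 1)%R by nra.
  have h1 : (Rabs ((a ^ 2 - b ^ 2) * u) <= a ^ 2 + b ^ 2)%R by apply/Rabs_le; nra.
  have h2 : (Rabs (2 * a * b * v) <= a ^ 2 + b ^ 2)%R.
    have p1 := pow2_ge_0 (a + b); have p2 := pow2_ge_0 (a - b).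
    have h3 : (Rabs (2 * a * b) <= a ^ 2 + b ^ 2)%R by apply/Rabs_le; lra.
    have h4 : (Rabs v <= 1)%R by apply/Rabs_le.
    rewrite Rabs_mult -[X in (_ <= X)%R]Rmult_1_r.
    by apply: Rmult_le_compat => //; exact: Rabs_pos.
  by apply: Rle_trans (Rabs_triang _ _) _; rewrite Rabs_Ropp; lra.
have sc x : (cos x * cos x + sin x * sin x = 1)%R.
  by have := sin2_cos2 x; rewrite /Rsqr; lra.
pose f s := (exp (a * s) * cos (b * s))%R.
pose f1 s := (exp (a * s) * (a * cos (b * s) - b * sin (b * s)))%R.
pose f2 s := (exp (a * s) * ((a ^ 2 - b ^ 2) * cos (b * s) - 2 * a * b * sin (b * s)))%R.
pose g s := (exp (a * s) * sin (b * s))%R.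
pose g1 s := (exp (a * s) * (a * sin (b * s) + b * cos (b * s)))%R.
(* Written with [- cos] so that [tb] applies to [f2] and to [g2] alike. *)
pose g2 s := (exp (a * s) * ((a ^ 2 - b ^ 2) * sin (b * s) - 2 * a * b * (- cos (b * s))))%R.
have hf : (Rabs (f 1 - f 0 - f1 0) <= 2 * (a ^ 2 + b ^ 2) * M)%R.
  apply: (@taylor2_bound f f1 f2) => s.
  - by rewrite /f /f1; auto_derive => //; ring.
  - by rewrite /f1 /f2; auto_derive => //; ring.
  - by move=> hs; apply: bd => //; apply: tb.
have hg : (Rabs (g 1 - g 0 - g1 0) <= 2 * (a ^ 2 + b ^ 2) * M)%R.
  apply: (@taylor2_bound g g1 g2) => s.
  - by rewrite /g /g1; auto_derive => //; ring.
  - by rewrite /g1 /g2; auto_derive => //; ring.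
  - move=> hs; apply: bd => //; apply: tb => //.
    by have := sc (b * s)%R; lra.
apply: Rle_trans (Cmod_le_Rabs _) _; rewrite mE.
move: hf hg; rewrite /f /f1 /g /g1 !Rmult_0_r !Rmult_1_r exp_0 cos_0 sin_0 /=.
set X := Rabs _; set Y := Rabs _; move=> hX hY.
have -> : Rabs (exp a * cos b + - (1) + - a) = X by congr Rabs; ring.
have -> : Rabs (exp a * sin b + - 0 + - b) = Y by congr Rabs; ring.
lra.
Qed.

End Complex_C.

(** * The product [psi] compared with the exponential of [Lam] *)

Section Complex_C2.
Local Open Scope C_scope.

(* Characteristic function of [\sum_j xi_j ln j], the [xi_j] being those of [Ebern]. *)
Fixpoint psi (n : nat) (th : R) : C :=
  if n is m.+1 then psi m th * (1 + RtoC (/ INR n) * (cis (th * ln (INR n)) - 1)) else 1.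

(** The free phase [c] absorbs the shift by [th * ln n] in the induction. It later carries the
    centring and the point at which the transform is inverted. *)
Lemma Ebern_trig (n : nat) (th c : R) :
  Ebern n (fun a => cos (th * a + c)) = Re (cis c * psi n th)
  /\ Ebern n (fun a => sin (th * a + c)) = Im (cis c * psi n th).
Proof.
elim: n c => [|n IH] c.
  by rewrite /= Rmult_0_r Rplus_0_l; split; ring.
have h := INR_S_neq0.
set l := ln (INR n.+1).
have [c1 s1] := IH c; have [c2 s2] := IH (th * l + c)%R.
have e (f : R -> R) : Ebern n (fun a => f (th * (a + l) + c)%R) = Ebern n (fun a => f (th * a + (th * l + c))%R).
  by congr Ebern; apply: functional_extensionality => a; congr f; ring.
rewrite [Ebern _ _]/= -/l (e cos) [in X in _ /\ X](_ : Ebern n.+1 (fun a => sin (th * a + c)%R)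
  = / INR n.+1 * Ebern n (fun a => sin (th * (a + l) + c)) + (1 - / INR n.+1) * Ebern n (fun a => sin (th * a + c)))%R //.
rewrite (e sin) c1 c2 s1 s2 cis_add [psi n.+1 th]/= -/l.
by case: (psi n th) (cis c) (cis (th * l)) => [p1 p2] [q1 q2] [r1 r2]; split => /=; ring.
Qed.

Lemma Cmod_psi_le1 (n : nat) (th : R) : (Cmod (psi n th) <= 1)%R.
Proof.
elim: n => [|n IH] /=; first by rewrite Cmod_1; lra.
rewrite Cmod_mult -[X in (_ <= X)%R]Rmult_1_r; apply: Rmult_le_compat => //; try exact: Cmod_ge_0.
have N0 := INR_S_gt0 n; have iN := Rinv_0_lt_compat _ N0.
have iN1 : (/ INR n.+1 <= 1)%R.
  by rewrite -Rinv_1; apply: Rinv_le_contravar; [lra|rewrite S_INR; have := pos_INR n; lra].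
set l := (th * _)%R.
have -> : 1 + RtoC (/ INR n.+1) * (cis l - 1)
          = RtoC (1 - / INR n.+1) + RtoC (/ INR n.+1) * cis l.
  by rewrite RtoC_minus; ring.
apply: Rle_trans (Cmod_triangle _ _) _.
by rewrite Cmod_mult Cmod_cis !Cmod_R !Rabs_pos_eq; lra.
Qed.

(* [\int_0^L (cis (th u) - 1) du] *)
Definition Lam (th L : R) : C := (sin (th * L) / th - L, (1 - cos (th * L)) / th)%R.

Lemma Rabs_1_sub_cos_le (y : R) : (Rabs (cos y - 1) <= 2 * Rabs y /\ Rabs (sin y) <= 2 * Rabs y)%R.
Proof.
have h := Cmod_cis_sub1 y.
have := Rmax_Cmod (cis y - 1) => /=; rewrite Ropp_0 Rplus_0_r => h2.
by split; [apply: Rle_trans (Rmax_l _ _) _|apply: Rle_trans (Rmax_r _ _) _]; exact: Rle_trans h2 h.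
Qed.

(** With [u = ln v], the increment of [Lam] is the integral of [(cis (th * ln v) - 1) / v] over an
    interval of length 1, and the term subtracted is the value at its right end. The error is thus a
    bound on the derivative of the integrand, which carries a factor [th] because [cis y - 1] is
    [O(y)]. *)
Lemma Lam_increment (n : nat) (th : R) : (0 < th <= 1)%R ->
  (Cmod (Lam th (ln (INR n.+2)) - Lam th (ln (INR n.+1))
         - RtoC (/ INR n.+2) * (cis (th * ln (INR n.+2)) - 1))
   <= 4 * th * (1 + ln (INR n.+2)) / INR n.+1 ^ 2)%R.
Proof.
move=> [t0 t1]; have N0 := INR_S_gt0 n; have M0 := INR_S_gt0 n.+1.
set a := INR n.+1 in N0 *; set b := INR n.+2 in M0 *.
have ab : (b = a + 1)%R by rewrite /a /b (S_INR n.+1).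
have a1 : (1 <= a)%R by rewrite /a S_INR; have := pos_INR n; lra.
have lb : (0 <= ln b)%R by rewrite -ln_1; apply: ln_le; lra.
pose B := (2 * th * (1 + ln b) / a ^ 2)%R.
have key (F F1 F2 : R -> R) : (forall v, 0 < v -> is_derive F v (F1 v))%R ->
    (forall v, 0 < v -> is_derive F1 v (F2 v))%R ->
    (forall v, a <= v <= b -> Rabs (F2 v) <= B)%R ->
    (Rabs (F b - F a - F1 b) <= B)%R.
  move=> d1 d2 bd.
  have -> : (F b - F a - F1 b = (F b - F1 b * b) - (F a - F1 b * a))%R.
    by rewrite {5}ab; ring.
  have := @Rabs_le_MVT (fun v => F v - F1 b * v)%R (fun v => F1 v - F1 b)%R a b B.
  rewrite Rmin_left ?Rmax_right; try lra.
  have -> : (Rabs (b - a) = 1)%R by rewrite ab Rabs_pos_eq; lra.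
  rewrite Rmult_1_r; apply.
    move=> v hv; have v0 : (0 < v)%R by lra.
    auto_derive; first by exists (F1 v); exact: d1.
    by rewrite (is_derive_unique _ _ _ (d1 v v0)); ring.
  move=> v hv; have h := @Rabs_le_MVT F1 F2 b v B.
  rewrite Rmin_right ?Rmax_left in h; try lra.
  have B0 : (0 <= B)%R by apply: Rle_trans (bd a _); [exact: Rabs_pos|lra].
  apply: Rle_trans (h _ _) _.
  - by move=> x hx; apply: d2; lra.
  - by move=> x hx; apply: bd; lra.
  - rewrite -[X in (_ <= X)%R]Rmult_1_r; apply: Rmult_le_compat_l => //.
    by apply/Rabs_le; lra.
have bd2 v x : (a <= v <= b)%R -> (Rabs x <= 2 * th * (1 + ln v))%R -> (Rabs (x / v ^ 2) <= B)%R.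
  move=> hv hx; have v0 : (0 < v)%R by lra.
  have v2 : (0 < v ^ 2)%R by apply: pow_lt.
  rewrite Rabs_div; last by lra.
  rewrite (Rabs_pos_eq (v ^ 2)); last by lra.
  apply: Rmult_le_compat; first exact: Rabs_pos.
  - by apply: Rlt_le; apply: Rinv_0_lt_compat.
  - apply: Rle_trans hx _; apply: Rmult_le_compat_l; first by lra.
    by have := @ln_le v b v0 ltac:(lra); lra.
  - by apply: Rinv_le_contravar; [apply: pow_lt|apply: pow_incr; lra].
have lv v : (a <= v <= b)%R -> (0 <= ln v)%R by move=> hv; rewrite -ln_1; apply: ln_le; lra.
have S1 x : (Rabs (sin x) <= 1)%R by apply/Rabs_le; have := SIN_bound x; lra.
have C1 x : (Rabs (cos x) <= 1)%R by apply/Rabs_le; have := COS_bound x; lra.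
have re : (Rabs ((sin (th * ln b) / th - ln b) - (sin (th * ln a) / th - ln a)
                - (cos (th * ln b) - 1) / b) <= B)%R.
  apply: (key (fun v => sin (th * ln v) / th - ln v)%R (fun v => (cos (th * ln v) - 1) / v)%R
            (fun v => (- th * sin (th * ln v) - (cos (th * ln v) - 1)) / v ^ 2)%R).
  - by move=> v v0; auto_derive; [split; [lra|]|field; lra].
  - by move=> v v0; auto_derive; [split; [lra|split; [lra|]]|field; lra].
  move=> v hv; apply: bd2 => //; have l0 := lv v hv.
  apply: Rle_trans (Rabs_triang _ _) _; rewrite Rabs_Ropp Rabs_mult Rabs_Ropp.
  have [h _] := Rabs_1_sub_cos_le (th * ln v).
  rewrite (Rabs_pos_eq (th * ln v)) in h; last by apply: Rmult_le_pos; lra.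
  rewrite (Rabs_pos_eq th); last by lra.
  by have := Rmult_le_compat_l th _ _ (Rlt_le _ _ t0) (S1 (th * ln v)%R); lra.
have im : (Rabs ((1 - cos (th * ln b)) / th - (1 - cos (th * ln a)) / th
                - sin (th * ln b) / b) <= B)%R.
  apply: (key (fun v => (1 - cos (th * ln v)) / th)%R (fun v => sin (th * ln v) / v)%R
            (fun v => (th * cos (th * ln v) - sin (th * ln v)) / v ^ 2)%R).
  - by move=> v v0; auto_derive; [|field; lra].
  - by move=> v v0; auto_derive; [split; [lra|split; [lra|]]|field; lra].
  move=> v hv; apply: bd2 => //; have l0 := lv v hv.
  apply: Rle_trans (Rabs_triang _ _) _; rewrite Rabs_Ropp Rabs_mult.
  have [_ h] := Rabs_1_sub_cos_le (th * ln v).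
  rewrite (Rabs_pos_eq (th * ln v)) in h; last by apply: Rmult_le_pos; lra.
  rewrite (Rabs_pos_eq th); last by lra.
  by have := Rmult_le_compat_l th _ _ (Rlt_le _ _ t0) (C1 (th * ln v)%R); lra.
apply: Rle_trans (Cmod_le_Rabs _) _.
have -> : (4 * th * (1 + ln b) / a ^ 2 = B + B)%R by rewrite /B; field; lra.
apply: Rplus_le_compat.
- by apply: Rle_trans _ re; apply: Req_le; congr Rabs => /=; rewrite -/a -/b; field; lra.
- by apply: Rle_trans _ im; apply: Req_le; congr Rabs => /=; rewrite -/a -/b; field; lra.
Qed.

End Complex_C2.

Section Complex_C3.
Local Open Scope C_scope.

Lemma inv_pow32_telescope (a : R) : (0 < a)%R ->
  (sqrt (a + 1) / (a + 1) ^ 2 <= 2 * (/ sqrt a - / sqrt (a + 1)))%R.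
Proof.
move=> a0; set p := sqrt a; set q := sqrt (a + 1).
have p0 : (0 < p)%R by apply: sqrt_lt_R0.
have p2 : (p * p = a)%R by apply: sqrt_sqrt; lra.
have q2 : (q * q = a + 1)%R by apply: sqrt_sqrt; lra.
have pq : (p < q)%R by apply: sqrt_lt_1; lra.
have -> : (q / (a + 1) ^ 2 = / (q * q * q))%R by rewrite -q2; field; lra.
have -> : (2 * (/ p - / q) = 2 / (p * q * (q + p)))%R.
  have e : ((q - p) * (q + p) = 1)%R by nra.
  have -> : (/ p - / q = (q - p) * (q + p) / (p * q * (q + p)))%R by field; lra.
  by rewrite e; field; lra.
have d1 : (0 < p * q * (q + p))%R by apply: Rmult_lt_0_compat; nra.
have d2 : (0 < q * q * q)%R by apply: Rmult_lt_0_compat; nra.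
apply: (Rmult_le_reg_r (q * q * q)) => //; rewrite Rinv_l; last by lra.
apply: (Rmult_le_reg_r (p * q * (q + p))) => //.
have -> : (2 / (p * q * (q + p)) * (q * q * q) * (p * q * (q + p)) = 2 * (q * q * q))%R.
  by field; lra.
have : (p * q * (q + p) <= q * q * (q + q))%R.
  by apply: Rmult_le_compat; try nra.
lra.
Qed.

(** One factor of [psi] against the exponential of one increment of [Lam]. The error is of order
    [th * ((1 + ln b) / b)^2]; it is put in telescoping form, so that the errors sum to [O(th)]
    uniformly in [n]. *)
Lemma psi_step : exists K : R, (0 < K)%R /\ forall (n : nat) (th : R), (0 < th <= 1)%R ->
  let L := ln (INR n.+2) in
  (Cmod ((1 + RtoC (/ INR n.+2) * (cis (th * L) - 1))
          * cexp (- (Lam th L - Lam th (ln (INR n.+1)))) - 1)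
   <= K * th * (/ sqrt (INR n.+1) - / sqrt (INR n.+2)))%R.
Proof.
have E18 := exp_pos 18.
(* Here [3888 * exp 18] is [3 * 4 * 18^2 * exp 18], from [cexp_taylor] with [Cmod d <= 18];
   [52 = 16 + 36] bounds [d - w] and [w * d]; [68 = 2 * 34] comes from [(1 + l)^2 <= 34 * sqrt b]
   and the telescoping bound. *)
exists (68 * (3888 * exp 18 + 52))%R; split; first by lra.
move=> n th ht /=; have inc := Lam_increment n ht.
set a := INR n.+1 in inc *; set b := INR n.+2 in inc *; set l := ln b in inc *.
have ab : (b = a + 1)%R by rewrite /a /b (S_INR n.+1).
have a1 : (1 <= a)%R by rewrite /a S_INR; have := pos_INR n; lra.
have l0 : (0 <= l)%R by rewrite /l -ln_1; apply: ln_le; lra.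
have lb : (l <= b - 1)%R by apply: ln_le_sub1; lra.
set w := RtoC (/ b) * (cis (th * l) - 1) in inc *.
set d := Lam th l - Lam th (ln a) in inc *.
pose be := ((1 + l) / b)%R.
have ib : (0 < / b)%R by apply: Rinv_0_lt_compat; lra.
have be0 : (0 < be)%R by apply: Rmult_lt_0_compat; lra.
have be1 : (be <= 1)%R.
  apply: (Rmult_le_reg_r b); first by lra.
  by have -> : (be * b = 1 + l)%R; [rewrite /be; field; lra|lra].
have ibe : (/ b <= be)%R.
  by rewrite /be /Rdiv -{1}(Rmult_1_l (/ b)); apply: Rmult_le_compat_r; lra.
have hw : (Cmod w <= 2 * th * be)%R.
  rewrite /w Cmod_mult Cmod_R (Rabs_pos_eq (/ b)); last by lra.
  have h := Cmod_cis_sub1 (th * l).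
  rewrite (Rabs_pos_eq (th * l)) in h; last by apply: Rmult_le_pos; lra.
  have -> : (2 * th * be = / b * (2 * (th * l) + 2 * th))%R by rewrite /be; field; lra.
  by apply: Rmult_le_compat_l; lra.
have hdw : (Cmod (d - w) <= 16 * th * be ^ 2)%R.
  apply: Rle_trans inc _.
  have a2 : (0 < a ^ 2)%R by apply: pow_lt; lra.
  apply: Rle_trans (_ : 16 * th * (be * / b) <= _)%R.
    have -> : (16 * th * (be * / b) = 16 * th * (1 + l) / b ^ 2)%R by rewrite /be; field; lra.
    apply: (Rmult_le_reg_r (a ^ 2 * b ^ 2)); first by apply: Rmult_lt_0_compat; nra.
    have -> : (4 * th * (1 + l) / a ^ 2 * (a ^ 2 * b ^ 2) = th * (1 + l) * (4 * b ^ 2))%R by field; lra.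
    have -> : (16 * th * (1 + l) / b ^ 2 * (a ^ 2 * b ^ 2) = th * (1 + l) * (16 * a ^ 2))%R by field; lra.
    by apply: Rmult_le_compat_l; nra.
  by apply: Rmult_le_compat_l; nra.
have hd : (Cmod d <= 18 * th * be)%R.
  have -> : d = w + (d - w) by ring.
  have h : (th * be * be <= th * be * 1)%R by apply: Rmult_le_compat_l; nra.
  by apply: Rle_trans (Cmod_triangle _ _) _; lra.
have tb : (0 <= th * be <= 1)%R by nra.
have hd18 : (Cmod d <= 18)%R by lra.
have hc : (Cmod (cexp (- d) - 1 - - d) <= 1296 * exp 18 * (th * be ^ 2))%R.
  apply: Rle_trans (cexp_taylor _) _; rewrite Cmod_opp.
  have hE : (exp (Rmax 0 (Re (- d))) <= exp 18)%R.
    apply: exp_mono; apply: Rmax_lub; first by lra.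
    have := Rmax_Cmod (- d); rewrite Cmod_opp => h.
    by have := Rmax_l (Rabs (fst (- d))) (Rabs (snd (- d))); have := Rle_abs (Re (- d)); rewrite /Re; lra.
  have d0 := Cmod_ge_0 d.
  have h2 : (Cmod d ^ 2 <= 324 * (th * be ^ 2))%R.
    have : (Cmod d ^ 2 <= (18 * th * be) ^ 2)%R by apply: pow_incr.
    have : (th ^ 2 * be ^ 2 <= th * be ^ 2)%R by apply: Rmult_le_compat_r; nra.
    nra.
  have := exp_pos (Rmax 0 (Re (- d))) => eP.
  have := Rmult_le_compat _ _ _ _ (pow_le _ 2 d0) (Rlt_le _ _ eP) h2 hE; lra.
apply: Rle_trans (_ : (3888 * exp 18 + 52) * th * be ^ 2 <= _)%R.
  (* The first-order terms cancel up to [d - w], which [Lam_increment] controls. *)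
  have -> : (1 + w) * cexp (- d) - 1
     = (1 + w) * (cexp (- d) - 1 - - d) + (- (d - w) + - (w * d)) by ring.
  apply: Rle_trans (Cmod_triangle _ _) _.
  have h1 : (Cmod (1 + w) <= 3)%R.
    by apply: Rle_trans (Cmod_triangle _ _) _; rewrite Cmod_1; nra.
  have h2 : (Cmod (- (d - w) + - (w * d)) <= 16 * th * be ^ 2 + 36 * (th * be ^ 2))%R.
    apply: Rle_trans (Cmod_triangle _ _) _; rewrite !Cmod_opp Cmod_mult.
    have := Rmult_le_compat _ _ _ _ (Cmod_ge_0 w) (Cmod_ge_0 d) hw hd.
    have : (th ^ 2 * be ^ 2 <= th * be ^ 2)%R by apply: Rmult_le_compat_r; nra.
    nra.
  rewrite Cmod_mult.
  by have := Rmult_le_compat _ _ _ _ (Cmod_ge_0 _) (Cmod_ge_0 _) h1 hc; lra.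
have hbe : (be ^ 2 <= 68 * (/ sqrt a - / sqrt b))%R.
  have t := inv_pow32_telescope (Rlt_le_trans _ _ _ Rlt_0_1 a1); rewrite -ab in t.
  have b1 : (1 <= b)%R by lra.
  have ls := ln_sq_le_sqrt b1; rewrite -/l in ls.
  have s1 : (1 <= sqrt b)%R by rewrite -sqrt_1; apply: sqrt_le_1; lra.
  have -> : (be ^ 2 = (1 + l) ^ 2 * / b ^ 2)%R by rewrite /be; field; lra.
  apply: Rle_trans (_ : 34 * sqrt b * / b ^ 2 <= _)%R; last by rewrite Rmult_assoc; lra.
  apply: Rmult_le_compat_r; first by apply: Rlt_le; apply: Rinv_0_lt_compat; nra.
  by have := pow2_ge_0 (1 - l); nra.
have := Rmult_le_compat_l ((3888 * exp 18 + 52) * th) _ _ ltac:(nra) hbe; lra.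
Qed.

(** A bound of the form [exp (sum of the errors) - 1] is preserved when one more factor is
    multiplied in. The sum telescopes to at most [K * th], and [exp x - 1 <= x * exp x]. *)
Lemma psi_approx : exists K : R, (0 < K)%R /\ forall (n : nat) (th : R), (0 < th <= 1)%R ->
  (Cmod (psi n.+1 th * cexp (- Lam th (ln (INR n.+1))) - 1) <= K * th)%R.
Proof.
have [K [K0 step]] := psi_step.
exists (K * exp K)%R; split; first by apply: Rmult_lt_0_compat => //; exact: exp_pos.
move=> n th ht.
have main : (Cmod (psi n.+1 th * cexp (- Lam th (ln (INR n.+1))) - 1)
             <= exp (K * th * (1 - / sqrt (INR n.+1))) - 1)%R.
  elim: n => [|n IH].
    rewrite INR_1 ln_1 sqrt_1 Rinv_1 Rminus_diag Rmult_0_r exp_0.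
    have -> : Lam th 0 = 0.
      by apply: C_eq; rewrite /= ?Rmult_0_r ?sin_0 ?cos_0; field; lra.
    have -> : - 0 = RtoC 0 by ring.
    rewrite cexp0 /psi INR_1 ln_1 Rmult_0_r.
    have -> : cis 0 = 1 by apply: C_eq; rewrite /= ?sin_0 ?cos_0.
    have -> : 1 * (1 + RtoC (/ 1) * (1 - 1)) * 1 - 1 = RtoC 0 by ring.
    by rewrite Cmod_0; lra.
  have := step n th ht; set L2 := ln (INR n.+2); set L1 := ln (INR n.+1) => /=.
  set q := (_ * cexp (- (Lam th L2 - Lam th L1))) => hq.
  set A := (K * th * (1 - / sqrt (INR n.+1)))%R in IH.
  set B := (K * th * (/ sqrt (INR n.+1) - / sqrt (INR n.+2)))%R in hq.
  have -> : (K * th * (1 - / sqrt (INR n.+2)) = A + B)%R by rewrite /A /B; ring.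
  set r := psi n.+1 th * cexp (- Lam th L1) in IH.
  have -> : psi n.+2 th * cexp (- Lam th L2) = r * q.
    rewrite /r /q [psi n.+2 th]/= -/(psi n.+1 th) -/L2.
    have -> : cexp (- Lam th L2) = cexp (- Lam th L1) * cexp (- (Lam th L2 - Lam th L1)).
      by rewrite -cexp_add; congr cexp; ring.
    by rewrite [psi n.+1 th]/=; ring.
  have qB : (Cmod (q - 1) <= exp B - 1)%R by have := exp_ineq1_le B; lra.
  have q1 : (Cmod q <= exp B)%R.
    have -> : q = 1 + (q - 1) by ring.
    by apply: Rle_trans (Cmod_triangle _ _) _; rewrite Cmod_1; lra.
  have -> : r * q - 1 = (r - 1) * q + (q - 1) by ring.
  apply: Rle_trans (Cmod_triangle _ _) _; rewrite Cmod_mult exp_plus.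
  by have := Rmult_le_compat _ _ _ _ (Cmod_ge_0 _) (Cmod_ge_0 _) IH q1; lra.
apply: Rle_trans main _.
set x := (K * th * (1 - / sqrt (INR n.+1)))%R.
have s1 : (0 < / sqrt (INR n.+1))%R.
  by apply: Rinv_0_lt_compat; apply: sqrt_lt_R0; exact: INR_S_gt0.
have xK : (x <= K * th)%R.
  by rewrite /x -[X in (_ <= X)%R]Rmult_1_r; apply: Rmult_le_compat_l; nra.
have Kt : (K * th <= K)%R by nra.
apply: Rle_trans (_ : exp (K * th) - 1 <= _)%R; first by have := exp_mono xK; lra.
have e : (exp (K * th) * exp (- (K * th)) = 1)%R by rewrite -exp_plus Rplus_opp_r exp_0.
have h1 := exp_ineq1_le (- (K * th)); have h2 := exp_pos (K * th).
have h3 := exp_mono Kt.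
have : (exp (K * th) * (1 + - (K * th)) <= 1)%R.
  by rewrite -e; apply: Rmult_le_compat_l; lra.
have : (K * th * exp (K * th) <= K * th * exp K)%R by apply: Rmult_le_compat_l; nra.
lra.
Qed.

End Complex_C3.

(** * Characteristic function against its Edgeworth approximation *)

Lemma one_plus_pow_exp_bound (k : nat) (c : R) : 0 < c ->
  exists K, 0 < K /\ forall x, 0 <= x -> exp (- c * x) <= K / (1 + x) ^ k.+1.
Proof.
move=> c0; exists (INR k.+1 ^ k.+1 / c ^ k.+1 * exp c).
have K0 := INR_S_gt0 k; have ck : 0 < c ^ k.+1 by apply: pow_lt.
split.
  apply: Rmult_lt_0_compat; last exact: exp_pos.
  by apply: Rdiv_lt_0_compat => //; apply: pow_lt.
move=> x x0; have x1 : 0 < (1 + x) ^ k.+1 by apply: pow_lt; lra.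
have h := @exp_ge_pow k (c * (1 + x)) ltac:(nra).
rewrite Rpow_mult_distr in h.
have e : exp (c * (1 + x)) * exp (- c * x) = exp c by rewrite -exp_plus; congr exp; ring.
have E0 := exp_pos (- c * x).
apply: (Rmult_le_reg_r ((1 + x) ^ k.+1 * c ^ k.+1)); first exact: Rmult_lt_0_compat.
have -> : INR k.+1 ^ k.+1 / c ^ k.+1 * exp c / (1 + x) ^ k.+1 * ((1 + x) ^ k.+1 * c ^ k.+1)
          = INR k.+1 ^ k.+1 * exp c by field; lra.
by rewrite -e; have := Rmult_le_compat_r _ _ _ (Rlt_le _ _ E0) h; lra.
Qed.

Lemma sin_taylor (y : R) : 0 <= y <= 2 ->
  y - y ^ 3 / 6 <= sin y <= y - y ^ 3 / 6 + y ^ 5 / 120.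
Proof.
move=> hy; have := @pre_sin_bound y 0 ltac:(lra) ltac:(lra).
rewrite /sin_approx /sin_term /= !INR_IZR_INZ /=.
by move=> [h1 h2]; split; [move: h1|move: h2]; lra.
Qed.

Lemma cos_taylor (y : R) : 0 <= y <= 2 ->
  1 - y ^ 2 / 2 + y ^ 4 / 24 - y ^ 6 / 720 <= cos y <= 1 - y ^ 2 / 2 + y ^ 4 / 24.
Proof.
move=> hy; have [_ h2] := @pre_cos_bound y 0 ltac:(lra) ltac:(lra).
have [h1 _] := @pre_cos_bound y 1 ltac:(lra) ltac:(lra).
move: h1 h2; rewrite /cos_approx /cos_term /= !INR_IZR_INZ /=.
by move=> h1 h2; split; [move: h1|move: h2]; lra.
Qed.

Lemma phase_small (y : R) : 0 < y <= 1 ->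
  0 <= sin y / y - 1 + y ^ 2 / 6 <= y ^ 4 / 120
  /\ Rabs ((1 - cos y) / y - y / 2 + y ^ 3 / 24) <= y ^ 4 / 120.
Proof.
move=> hy; have [s1 s2] := @sin_taylor y ltac:(lra); have [c1 c2] := @cos_taylor y ltac:(lra).
have ay : sin y / y * y = sin y by field; lra.
have cy : (1 - cos y) / y * y = 1 - cos y by field; lra.
have mul (a b : R) : a * y <= b * y -> a <= b by move=> h; apply: Rmult_le_reg_r h; lra.
have y5 := pow_le y 5 ltac:(lra).
have y6 : y ^ 6 <= y ^ 5 by rewrite [y ^ 6]/= -/(y ^ 5); nra.
move: ay cy; set a := sin y / y; set b := (1 - cos y) / y => ay cy.
by split; [split|apply/Rabs_le; split]; apply: mul; lra.
Qed.

(** For [y >= 1] the exponent then has real part at most [- L / 10]. Taylor's bound covers [[1, 2]],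
    and [sin y <= 1] the rest. *)
Lemma sinc_le (y : R) : 1 <= y -> sin y / y - 1 <= - / 10.
Proof.
move=> y1; apply: (Rmult_le_reg_r y); first by lra.
have -> : (sin y / y - 1) * y = sin y - y by field; lra.
case: (Rle_lt_dec y 2) => y2; last by have := SIN_bound y; lra.
have [_ h] := @sin_taylor y ltac:(lra).
have h2 : y ^ 3 / 6 - y ^ 5 / 120 = y * (y ^ 2 / 6 - y ^ 2 * y ^ 2 / 120) by field.
have w1 : 1 <= y ^ 2 by nra.
have w4 : y ^ 2 <= 4 by nra.
have w5 : 0 <= (y ^ 2 - 1) * (4 - y ^ 2) by apply: Rmult_le_pos; lra.
have h3 : / 10 <= y ^ 2 / 6 - y ^ 2 * y ^ 2 / 120 by lra.
have := Rmult_le_compat_l y _ _ ltac:(lra) h3; lra.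
Qed.

Section Complex_C4.
Local Open Scope C_scope.

(* In the variable [y = th * L], [L * (sin y / y - 1)] and [L * ((1 - cos y) / y - y / 2)] are the
   real and imaginary parts of the centred exponent, and the variable [t] conjugate to the
   normalised statistic satisfies [t ^ 2 = L * y ^ 2 / 3]. *)
Lemma edgeworth_small : forall K : R, (0 < K)%R -> exists K' : R, (0 < K')%R /\
  forall (L y g : R) (rho : C), (1 <= L)%R -> (0 < y <= 1)%R ->
  (Cmod (rho - 1) <= K / L)%R -> (1 - / L <= g <= 1)%R ->
  (Cmod (cexp (L * (sin y / y - 1), L * ((1 - cos y) / y - y / 2)) * rho * RtoC g
         - RtoC (exp (- (L * y ^ 2 / 6))) * (1, - (L * y ^ 3 / 24)))
   <= K' / (L * (1 + L * y ^ 2)))%R.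
Proof.
(* The rate [1 / 8] is below [1 / 6 - 1 / 120], which leaves room for [exp (Re z) <= exp (s / 120)].
   Of the four powers of [1 + s], three absorb the polynomial error and one makes the bound
   integrable. *)
move=> K K0; have [E [E0 hE]] := @one_plus_pow_exp_bound 3 (/ 8) ltac:(lra).
exists ((K + 6) * E)%R; split; first by apply: Rmult_lt_0_compat; lra.
move=> L y g rho L1 hy hrho hg.
have [r1 r2] := phase_small hy; set s := (L * y ^ 2)%R.
have y2 : (0 < y ^ 2 <= 1)%R by split; [apply: pow_lt; lra|nra].
have y4 : (y ^ 4 = y ^ 2 * y ^ 2)%R by ring.
have iL : (0 < / L <= 1)%R.
  by split; [apply: Rinv_0_lt_compat; lra|rewrite -Rinv_1; apply: Rinv_le_contravar; lra].
have s0 : (0 <= s)%R by rewrite /s; nra.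
set G := exp _; have G0 : (0 < G)%R := exp_pos _.
(* What is left of the exponent once the Gaussian factor [G] is taken out; its leading term is the
   cubic [iq]. *)
pose z : C := (L * (sin y / y - 1 + y ^ 2 / 6), L * ((1 - cos y) / y - y / 2))%R.
have -> : cexp (L * (sin y / y - 1), L * ((1 - cos y) / y - y / 2))%R = RtoC G * cexp z.
  have -> : RtoC G = cexp (RtoC (- (L * y ^ 2 / 6))%R).
    by rewrite cexp_real.
  rewrite -cexp_add; congr cexp; apply: C_eq => /=; field; lra.
set iq : C := (0, - (L * y ^ 3 / 24))%R.
have -> : (1, - (L * y ^ 3 / 24))%R = 1 + iq :> C by apply: C_eq => /=; ring.
have -> : RtoC G * cexp z * rho * RtoC g - RtoC G * (1 + iq)
  = RtoC G * (cexp z * (rho * RtoC g - 1) + ((cexp z - 1 - z) + (z - iq))) by ring.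
rewrite Cmod_mult Cmod_R (Rabs_pos_eq G); last by lra.
have Rz : (0 <= Re z <= s / 120)%R.
  rewrite /z /= /s; split; first by nra.
  have := Rmult_le_compat_l L _ _ ltac:(lra) (proj2 r1).
  have : (L * (y ^ 2 * y ^ 2) <= L * y ^ 2 * 1)%R by rewrite -Rmult_assoc; apply: Rmult_le_compat_l; nra.
  rewrite y4; lra.
have hzq : (Cmod (z - iq) <= L * y ^ 4 / 60)%R.
  apply: Rle_trans (Cmod_le_Rabs _) _; rewrite /z /iq /=.
  have -> : (L * (sin y / y - 1 + y * (y * 1) / 6) + - 0 = L * (sin y / y - 1 + y ^ 2 / 6))%R by field; lra.
  have -> : (L * ((1 - cos y) / y - y / 2) + - - (L * (y * (y * (y * 1))) / 24)
             = L * ((1 - cos y) / y - y / 2 + y ^ 3 / 24))%R by field; lra.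
  rewrite !Rabs_mult (Rabs_pos_eq L); last by lra.
  rewrite (Rabs_pos_eq (_ - 1 + _)); last by lra.
  have := Rmult_le_compat_l L _ _ ltac:(lra) (proj2 r1).
  have := Rmult_le_compat_l L _ _ ltac:(lra) r2.
  rewrite /=; lra.
have hz : (Cmod z <= L * y ^ 3)%R.
  have -> : z = (z - iq) + iq by ring.
  apply: Rle_trans (Cmod_triangle _ _) _.
  have : (Cmod iq <= L * y ^ 3 / 24)%R.
    apply: Rle_trans (Cmod_le_Rabs _) _; rewrite /iq /= Rabs_R0 Rabs_Ropp Rabs_pos_eq; first by lra.
    by have := pow_le y 3 ltac:(lra) => /= h; nra.
  have : (L * y ^ 4 <= L * y ^ 3)%R.
    apply: Rmult_le_compat_l; first by lra.
    by have := pow_le y 3 ltac:(lra) => h; rewrite [(y ^ 4)%R]/= -/(y ^ 3)%R; nra.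
  have : (0 <= L * y ^ 3)%R by apply: Rmult_le_pos; [lra|apply: pow_le; lra].
  lra.
have hrg : (Cmod (rho * RtoC g - 1) <= (K + 1) / L)%R.
  have -> : rho * RtoC g - 1 = (rho - 1) * RtoC g + RtoC (g - 1) by rewrite RtoC_minus; ring.
  apply: Rle_trans (Cmod_triangle _ _) _; rewrite Cmod_mult !Cmod_R (Rabs_pos_eq g); last by lra.
  have -> : (Rabs (g - 1) = 1 - g)%R by rewrite Rabs_left1; lra.
  have := Rmult_le_compat _ _ _ _ (Cmod_ge_0 _) _ hrho (proj2 hg); rewrite Rmult_1_r => h.
  have := h ltac:(lra); rewrite /Rdiv; lra.
have eR : (1 <= exp (Re z))%R by rewrite -exp_0; apply: exp_mono; lra.
have h1 : (Cmod (cexp z * (rho * RtoC g - 1)) <= exp (Re z) * ((K + 1) / L))%R.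
  by rewrite Cmod_mult Cmod_cexp; apply: Rmult_le_compat_l; lra.
have h2 : (Cmod (cexp z - 1 - z) <= exp (Re z) * (4 * s ^ 3 / L))%R.
  apply: Rle_trans (cexp_taylor z) _; rewrite Rmax_right; last by lra.
  have -> : (4 * s ^ 3 / L = 4 * (L * y ^ 3) ^ 2)%R by rewrite /s; field; lra.
  rewrite [X in (_ <= X)%R]Rmult_comm; apply: Rmult_le_compat_r; first by lra.
  apply: Rmult_le_compat_l; first by lra.
  by apply: pow_incr; split; [exact: Cmod_ge_0|].
have h3 : (Cmod (z - iq) <= exp (Re z) * (s ^ 2 / L))%R.
  apply: Rle_trans hzq _.
  have -> : (s ^ 2 / L = L * y ^ 4)%R by rewrite /s; field; lra.
  have : (0 <= L * y ^ 4)%R by apply: Rmult_le_pos; [lra|apply: pow_le; lra].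
  nra.
have tot : (Cmod (cexp z * (rho * RtoC g - 1) + ((cexp z - 1 - z) + (z - iq)))
            <= exp (Re z) * ((K + 6) * (1 + s) ^ 3 / L))%R.
  apply: Rle_trans (Cmod_triangle _ _) _.
  have t2 := Cmod_triangle (cexp z - 1 - z) (z - iq).
  apply: Rle_trans (_ : exp (Re z) * ((K + 1) / L + 4 * s ^ 3 / L + s ^ 2 / L) <= _)%R.
    by rewrite !Rmult_plus_distr_l; lra.
  apply: Rmult_le_compat_l; first by lra.
  rewrite /Rdiv -!Rmult_plus_distr_r; apply: Rmult_le_compat_r; first by lra.
  have s2 : (0 <= s ^ 2)%R by apply: pow_le.
  have s3 : (0 <= s ^ 3)%R by apply: pow_le.
  have -> : ((K + 6) * (1 + s) ^ 3 = (K + 6) * (1 + 3 * s + 3 * s ^ 2 + s ^ 3))%R by ring.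
  nra.
apply: Rle_trans (Rmult_le_compat_l _ _ _ (Rlt_le _ _ G0) tot) _.
have Ge : (G * exp (Re z) <= exp (- / 8 * s))%R.
  by rewrite /G -exp_plus; apply: exp_mono; rewrite -/s; lra.
have hEs := hE s s0.
have q0 : (0 < (1 + s) ^ 3)%R by apply: pow_lt; lra.
have -> : ((K + 6) * E / (L * (1 + s)) = E / (1 + s) ^ 4 * ((K + 6) * (1 + s) ^ 3 / L))%R.
  by field; lra.
rewrite -Rmult_assoc; apply: Rmult_le_compat_r; last by lra.
by apply: Rmult_le_pos; [apply: Rmult_le_pos; lra|lra].
Qed.

Lemma edge_tail : exists K : R, (0 < K)%R /\ forall L y : R, (1 <= L)%R -> (1 <= y)%R ->
  (Cmod (RtoC (exp (- (L * y ^ 2 / 6))) * (1, - (L * y ^ 3 / 24)))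
   <= K / (L * (1 + L * y ^ 2)))%R.
Proof.
have [E [E0 hE]] := @one_plus_pow_exp_bound 3 (/ 6) ltac:(lra).
exists E; split=> // L y L1 y1; set s := (L * y ^ 2)%R.
have yy : (y <= y ^ 2)%R by nra.
have sL : (L <= s)%R by rewrite /s; nra.
have sy : (y <= s)%R by rewrite /s; nra.
have -> : (- (s / 6) = - / 6 * s)%R by field.
have hEs := hE s ltac:(lra).
rewrite Cmod_mult Cmod_R Rabs_pos_eq; last exact: Rlt_le (exp_pos _).
have h : (Cmod (1, - (L * y ^ 3 / 24))%R <= (1 + s) ^ 2)%R.
  apply: Rle_trans (Cmod_le_Rabs _) _; rewrite /= Rabs_R1 Rabs_Ropp.
  have -> : (L * (y * (y * (y * 1))) / 24 = s * y / 24)%R by rewrite /s; field.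
  by rewrite Rabs_pos_eq; nra.
have s4 : (0 < (1 + s) ^ 4)%R by apply: pow_lt; lra.
have := Rmult_le_compat _ _ _ _ (Rlt_le _ _ (exp_pos _)) (Cmod_ge_0 _) hEs h => h2.
apply: Rle_trans h2 _.
have -> : (E / (1 + s) ^ 4 * (1 + s) ^ 2 = E / ((1 + s) * (1 + s)))%R by field; lra.
apply: Rmult_le_compat_l; first by lra.
by apply: Rinv_le_contravar; nra.
Qed.

(** Two sources of decay. For [1 <= y <= L] it is the real part of the exponent, by [sinc_le]; for
    [y >= L], that is [th >= 1], it is the smoothing factor [gauss (t / L)], equal to
    [exp (- (y^2 / (6 L)))]. *)
Lemma exp_large_y : exists K : R, (0 < K)%R /\ forall L y : R, (1 <= L)%R -> (1 <= y)%R ->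
  ((y <= L)%R -> (exp (- (L / 10)) <= K / (L * (1 + L * y ^ 2)))%R) /\
  ((L <= y)%R -> (exp (- (y ^ 2 / (6 * L))) <= K / (L * (1 + L * y ^ 2)))%R).
Proof.
have [E1 [E10 h1]] := @one_plus_pow_exp_bound 3 (/ 10) ltac:(lra).
have [E2 [E20 h2]] := @one_plus_pow_exp_bound 3 (/ 6) ltac:(lra).
exists (E1 + E2)%R; split; first by lra.
move=> L y L1 y1; have d0 : (0 < L * (1 + L * y ^ 2))%R by apply: Rmult_lt_0_compat; nra.
have id := Rinv_0_lt_compat _ d0.
split=> hy.
- have -> : (- (L / 10) = - / 10 * L)%R by field.
  apply: Rle_trans (h1 L _) _; first by lra.
  rewrite /Rdiv; apply: Rle_trans (_ : E1 * / (L * (1 + L * y ^ 2)) <= _)%R; last by nra.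
  apply: Rmult_le_compat_l; first by lra.
  apply: Rinv_le_contravar => //.
  have : (y ^ 2 <= L ^ 2)%R by apply: pow_incr; lra.
  have -> : ((1 + L) ^ 4 = 1 + 4 * L + 6 * L ^ 2 + 4 * L ^ 3 + L * (L * L ^ 2))%R by ring.
  move=> hh; have : (L * (L * y ^ 2) <= L * (L * L ^ 2))%R by apply: Rmult_le_compat_l; nra.
  have := pow_le L 2 ltac:(lra); have := pow_le L 3 ltac:(lra); lra.
- set u := (y ^ 2 / L)%R.
  have -> : (- (y ^ 2 / (6 * L)) = - / 6 * u)%R by rewrite /u; field; lra.
  have yu : (y ^ 2 = u * L)%R by rewrite /u; field; lra.
  have uL : (L <= u)%R.
    by apply: (Rmult_le_reg_r L); [lra|rewrite -yu; nra].
  apply: Rle_trans (h2 u _) _; first by lra.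
  rewrite /Rdiv; apply: Rle_trans (_ : E2 * / (L * (1 + L * y ^ 2)) <= _)%R; last by nra.
  apply: Rmult_le_compat_l; first by lra.
  apply: Rinv_le_contravar => //; rewrite yu.
  have -> : ((1 + u) ^ 4 = 1 + 4 * u + 6 * u ^ 2 + 4 * u ^ 3 + u * (u * (u * u)))%R by ring.
  have h3 : (L * (L * (u * L)) <= u * (u * (u * u)))%R.
    apply: Rmult_le_compat; [lra|nra|done|].
    by apply: Rmult_le_compat; [lra|nra|done|apply: Rmult_le_compat_l; lra].
  have := pow_le u 3 ltac:(lra); have := pow_le u 2 ltac:(lra); lra.
Qed.

End Complex_C4.

Definition sg (L : R) : R := sqrt (/ 3 * L ^ 3).

(** One sixth of the skewness: the cumulants attached to the exponent [Lam] are the integrals of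
    [u^k] over [[0, L]], so the mean is [L^2 / 2], the variance [L^3 / 3] and the third cumulant
    [L^4 / 4], whence [kap L = L^4 / (24 * sg L ^ 3)]. *)
Definition kap (L : R) : R := 3 * sqrt 3 / (24 * sqrt L).

Lemma sg_sq (L : R) : 0 < L -> sg L ^ 2 = L ^ 3 / 3.
Proof. by move=> L0; rewrite /sg pow2_sqrt; [field|have := pow_lt L 3 L0; lra]. Qed.

Lemma sg_gt0 (L : R) : 0 < L -> 0 < sg L.
Proof. by move=> L0; apply: sqrt_lt_R0; have := pow_lt L 3 L0; lra. Qed.

Lemma kap_gt0 (L : R) : 0 < L -> 0 < kap L.
Proof.
move=> L0; have s := sqrt_lt_R0 L L0; have s3 := sqrt_lt_R0 3 ltac:(lra).
by apply: Rdiv_lt_0_compat; lra.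
Qed.

Lemma sg_kap (L : R) : 0 < L -> kap L * sg L ^ 3 = L ^ 4 / 24.
Proof.
move=> L0; have s := sqrt_lt_R0 L L0; have s3 := sqrt_lt_R0 3 ltac:(lra).
have q3 : sqrt 3 * sqrt 3 = 3 by apply: sqrt_sqrt; lra.
have qL : sqrt L * sqrt L = L by apply: sqrt_sqrt; lra.
have e : sg L = L * sqrt L / sqrt 3.
  rewrite /sg; apply: sqrt_lem_1.
  - by have := pow_lt L 3 L0; lra.
  - by apply: Rlt_le; apply: Rdiv_lt_0_compat; nra.
  - have -> : L * sqrt L / sqrt 3 * (L * sqrt L / sqrt 3)
            = L * L * (sqrt L * sqrt L) / (sqrt 3 * sqrt 3) by field; lra.
    by rewrite q3 qL; field.
have -> : sg L ^ 3 = sg L * sg L ^ 2 by ring.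
rewrite sg_sq // {1}e /kap; field; lra.
Qed.

Section Complex_C5.
Local Open Scope C_scope.

Definition charf (n : nat) (t : R) : C :=
  let L := ln (INR n) in cis (- (t / sg L * (L ^ 2 / 2))) * psi n (t / sg L).

(** Characteristic function of [edgeworth_pdf]: the pair is [1 + kap L * (i t)^3]. *)
Definition edge (L t : R) : C := RtoC (gauss t) * (1, - (kap L * t ^ 3))%R.

(** Three ranges of [y = th * L]: Taylor expansion for [y <= 1], and for [1 <= y <= L] and [y > L]
    smallness of both terms separately. In the last range [psi] is bounded by 1 only. *)
Lemma charf_edge : exists K : R, (0 < K)%R /\ forall (n : nat) (t : R),
  let L := ln (INR n.+1) in (1 <= L)%R -> (0 < t)%R ->
  (Cmod (charf n.+1 t * RtoC (gauss (t / L)) - edge L t) <= K / (L * (1 + t ^ 2)))%R.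
Proof.
have [K [K0 hpsi]] := psi_approx.
have [K1 [K10 small]] := edgeworth_small K0.
have [K2 [K20 tail]] := edge_tail.
have [K3 [K30 large]] := exp_large_y.
exists (K1 + K2 + K3 * (1 + K))%R; split; first by nra.
move=> n t L L1 t0; have L0 : (0 < L)%R by lra.
have sg0 := sg_gt0 L0; have sg2 := sg_sq L0; have sgk := sg_kap L0.
rewrite /charf -/L; set th := (t / sg L)%R; set y := (th * L)%R.
have th0 : (0 < th)%R by apply: Rdiv_lt_0_compat.
have y0 : (0 < y)%R by apply: Rmult_lt_0_compat.
have tE : (t = th * sg L)%R by rewrite /th; field; lra.
have thE : (th = y / L)%R by rewrite /y; field; lra.
have t2 : (t ^ 2 = L * y ^ 2 / 3)%R.
  by rewrite tE Rpow_mult_distr sg2 /y; field.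
have t3 : (kap L * t ^ 3 = L * y ^ 3 / 24)%R.
  have -> : (kap L * t ^ 3 = th ^ 3 * (kap L * sg L ^ 3))%R by rewrite {1}tE; ring.
  by rewrite sgk /y; field.
have eE : edge L t = RtoC (exp (- (L * y ^ 2 / 6))) * (1, - (L * y ^ 3 / 24))%R.
  rewrite /edge t3; congr (RtoC _ * _); rewrite /gauss; congr exp.
  by rewrite /Rdiv Ropp_mult_distr_l_reverse -/(t ^ 2 / 2)%R t2; field.
have gE : gauss (t / L) = exp (- (y ^ 2 / (6 * L))).
  rewrite /gauss; congr exp.
  have -> : (- (t / L) ^ 2 / 2 = - (t ^ 2 / L ^ 2) / 2)%R by field; lra.
  by rewrite t2; field; lra.
have d0 : (0 < L * (1 + L * y ^ 2))%R by apply: Rmult_lt_0_compat; [lra|nra].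
have fin A : (0 <= A)%R -> (A / (L * (1 + L * y ^ 2)) <= A / (L * (1 + t ^ 2)))%R.
  move=> A0; apply: Rmult_le_compat_l => //; apply: Rinv_le_contravar.
    by apply: Rmult_lt_0_compat; nra.
  by apply: Rmult_le_compat_l; [lra|rewrite t2; nra].
have more A B : (0 <= A <= B)%R -> (A / (L * (1 + L * y ^ 2)) <= B / (L * (1 + t ^ 2)))%R.
  move=> hA; apply: Rle_trans (_ : B / (L * (1 + L * y ^ 2)) <= _)%R; last by apply: fin; lra.
  by apply: Rmult_le_compat_r; [apply: Rlt_le; apply: Rinv_0_lt_compat|lra].
have KK : (0 < K3 * K)%R by apply: Rmult_lt_0_compat.
rewrite eE gE; set g := exp (- (y ^ 2 / (6 * L))).
have g0 : (0 < g)%R by exact: exp_pos.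
case: (Rle_lt_dec th 1) => th1; last first.
  have Ly : (L <= y)%R by rewrite /y; nra.
  have [_ hl] := large L y L1 ltac:(lra); have := hl Ly; rewrite -/g => hg.
  have ht := tail L y L1 ltac:(lra).
  apply: Rle_trans (Cmod_triangle _ _) _; rewrite Cmod_opp (Cmod_mult _ (RtoC g)) (Cmod_mult (cis _)) Cmod_cis Cmod_R Rabs_pos_eq; last by lra.
  have h1 : (1 * Cmod (psi n.+1 th) * g <= g)%R.
    by have := Cmod_psi_le1 n.+1 th; nra.
  apply: Rle_trans (more (K3 + K2)%R _ _); last by lra.
  rewrite Rdiv_plus_distr.
  by apply: Rplus_le_compat; [exact: Rle_trans h1 hg|exact: ht].
have hr := hpsi n th ltac:(lra); rewrite -/L in hr.
set rho := psi n.+1 th * cexp (- Lam th L) in hr.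
have pE : cis (- (th * (L ^ 2 / 2))) * psi n.+1 th
  = cexp (L * (sin y / y - 1), L * ((1 - cos y) / y - y / 2))%R * rho.
  have -> : cexp (L * (sin y / y - 1), L * ((1 - cos y) / y - y / 2))%R
     = cis (- (th * (L ^ 2 / 2))) * cexp (Lam th L).
    rewrite -cexp_imag -cexp_add; congr cexp; apply: C_eq; rewrite /Lam /= -/y.
      by rewrite thE; field; lra.
    by rewrite thE; field; lra.
  rewrite /rho.
  transitivity (cis (- (th * (L ^ 2 / 2))) * psi n.+1 th * (cexp (Lam th L) * cexp (- Lam th L))).
    by rewrite cexp_opp; ring.
  by ring.
rewrite pE.
have rK : (Cmod (rho - 1) <= K * th)%R by [].
case: (Rle_lt_dec y 1) => y1.
  apply: Rle_trans (_ : K1 / (L * (1 + L * y ^ 2)) <= _)%R; first apply: small; try lra.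
  - apply: Rle_trans hr _; rewrite thE /Rdiv -Rmult_assoc; apply: Rmult_le_compat_r.
      by apply: Rlt_le; apply: Rinv_0_lt_compat.
    by rewrite -[X in (_ <= X)%R]Rmult_1_r; apply: Rmult_le_compat_l; lra.
  - have x0 : (0 <= y ^ 2 / (6 * L) <= / L)%R.
      split; first by apply: Rlt_le; apply: Rdiv_lt_0_compat; [exact: pow_lt|lra].
      apply: (Rmult_le_reg_r (6 * L)); first by lra.
      have -> : (y ^ 2 / (6 * L) * (6 * L) = y ^ 2)%R by field; lra.
      have -> : (/ L * (6 * L) = 6)%R by field; lra.
      nra.
    split; first by have := exp_ineq1_le (- (y ^ 2 / (6 * L))); rewrite -/g; lra.
    by rewrite /g -exp_0; apply: exp_mono; lra.
  - have h : (0 < K3 * (1 + K))%R by apply: Rmult_lt_0_compat; lra.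
    by apply: more; split; lra.
have yL : (y <= L)%R by rewrite /y; nra.
have [hl _] := large L y L1 ltac:(lra); have hE := hl yL.
have ht := tail L y L1 ltac:(lra).
have g1 : (g <= 1)%R.
  rewrite /g -exp_0; apply: exp_mono.
  have : (0 < y ^ 2 / (6 * L))%R by apply: Rdiv_lt_0_compat; [exact: pow_lt|lra].
  lra.
have rho1 : (Cmod rho <= 1 + K)%R.
  have -> : rho = 1 + (rho - 1) by ring.
  by apply: Rle_trans (Cmod_triangle _ _) _; rewrite Cmod_1; nra.
apply: Rle_trans (Cmod_triangle _ _) _; rewrite Cmod_opp (Cmod_mult _ (RtoC g)) Cmod_mult Cmod_cexp Cmod_R (Rabs_pos_eq g); last by lra.
rewrite [Re _]/=.
have e1 : (exp (L * (sin y / y - 1)) <= exp (- (L / 10)))%R.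
  by apply: exp_mono; have := @sinc_le y ltac:(lra); nra.
have h1 : (exp (L * (sin y / y - 1)) * Cmod rho * g <= K3 * (1 + K) / (L * (1 + L * y ^ 2)))%R.
  have a := Rmult_le_compat _ _ _ _ (Rlt_le _ _ (exp_pos _)) (Cmod_ge_0 rho) (Rle_trans _ _ _ e1 hE) rho1.
  have b : (0 <= exp (L * (sin y / y - 1)) * Cmod rho)%R.
    by apply: Rmult_le_pos; [exact: Rlt_le (exp_pos _)|exact: Cmod_ge_0].
  have -> : (K3 * (1 + K) / (L * (1 + L * y ^ 2)) = K3 / (L * (1 + L * y ^ 2)) * (1 + K))%R by rewrite /Rdiv; ring.
  by have := Rmult_le_compat_l _ _ _ b g1; lra.
apply: Rle_trans (more (K3 * (1 + K) + K2)%R _ _); last by lra.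
by rewrite Rdiv_plus_distr; apply: Rplus_le_compat.
Qed.

End Complex_C5.

(** * Edgeworth expansion of the Bernoulli sum *)

Lemma Ebern_ext (n : nat) (f g : R -> R) : (forall a, f a = g a) -> Ebern n f = Ebern n g.
Proof. by move=> h; congr Ebern; apply: functional_extensionality. Qed.

Lemma Ebern_le (n : nat) (f g : R -> R) : (forall a, f a <= g a) -> Ebern n f <= Ebern n g.
Proof. by move=> h; rewrite -!Ecyc_log_remainders; apply: Ecyc_le. Qed.

Lemma Ebern_const (n : nat) (c : R) : Ebern n (fun=> c) = c.
Proof. by rewrite -Ecyc_log_remainders Ecyc_const. Qed.

Lemma EbernZ (n : nat) (c : R) (f : R -> R) : Ebern n (fun a => c * f a) = c * Ebern n f.
Proof. by rewrite -!Ecyc_log_remainders (EcycZ n c (fun l => f (log_remainders l))). Qed.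

(** [Ebern] is a finite combination of values of its argument, so derivatives, and below limits and
    integrals, pass through it by induction. *)
Lemma is_derive_Ebern (n : nat) (f df : R -> R -> R) (z : R) :
  (forall a, is_derive (fun z => f z a) z (df z a)) ->
  is_derive (fun z => Ebern n (f z)) z (Ebern n (df z)).
Proof.
elim: n f df => [|n IH] f df h /=; first exact: h.
have h1 := IH (fun z a => f z (a + ln (INR n.+1))) (fun z a => df z (a + ln (INR n.+1))) (fun a => h _).
have h2 := IH f df h.
by apply: is_derive_plus; apply: is_derive_scal.
Qed.

Lemma is_lim_Ebern (n : nat) (f : R -> R -> R) (l : R -> R) :
  (forall a, is_lim (fun T => f T a) p_infty (l a)) ->
  is_lim (fun T => Ebern n (f T)) p_infty (Ebern n l).
Proof.
elim: n f l => [|n IH] f l h /=; first exact: h.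
have h1 := IH (fun z a => f z (a + ln (INR n.+1))) (fun a => l (a + ln (INR n.+1))) (fun a => h _).
have h2 := IH f l h.
have s1 := is_lim_scal_l _ (/ INR n.+1) _ _ h1.
have s2 := is_lim_scal_l _ (1 - / INR n.+1) _ _ h2.
exact: is_lim_plus' s1 s2.
Qed.

Lemma is_RInt_Ebern (n : nat) (f : R -> R -> R) (v : R -> R) (a b : R) :
  (forall x, is_RInt (fun t => f t x) a b (v x)) ->
  is_RInt (fun t => Ebern n (f t)) a b (Ebern n v).
Proof.
elim: n f v => [|n IH] f v h /=; first exact: h.
have h1 := IH (fun z a => f z (a + ln (INR n.+1))) (fun a => v (a + ln (INR n.+1))) (fun a => h _).
have h2 := IH f v h.
by apply: is_RInt_plus; apply: is_RInt_scal.
Qed.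

Definition standardize (L a : R) : R := (a - L ^ 2 / 2) / sg L.

(* Distribution function of the standardised Bernoulli sum, convolved with a centred normal law of
   standard deviation [1 / L]. *)
Definition smooth_cdf (n : nat) (z : R) : R :=
  let L := ln (INR n) in Ebern n (fun a => Phi ((z - standardize L a) * L)).

Definition smooth_pdf (n : nat) (z : R) : R :=
  let L := ln (INR n) in Ebern n (fun a => phi ((z - standardize L a) * L) * L).

Definition edgeworth_cdf (L z : R) : R := Phi z + kap L * (1 - z ^ 2) * phi z.

Definition edgeworth_pdf (L z : R) : R := phi z * (1 + kap L * (z ^ 3 - 3 * z)).

Lemma is_derive_phi (z : R) : is_derive phi z (- z * phi z).
Proof.
rewrite /phi; have h := half_mass_gt0; rewrite sqrt_2PI.
auto_derive; first exact: ex_derive_gauss.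
by rewrite Derive_gauss; field; lra.
Qed.

Lemma is_derive_smooth_cdf (n : nat) (z : R) : is_derive (smooth_cdf n) z (smooth_pdf n z).
Proof.
apply: (@is_derive_Ebern n (fun z a => Phi ((z - standardize (ln (INR n)) a) * ln (INR n)))
          (fun z a => phi ((z - standardize (ln (INR n)) a) * ln (INR n)) * ln (INR n))) => a.
set L := ln _; set s := standardize _ _.
have e : Derive (fun x => Phi x) ((z - s) * L) = phi ((z - s) * L).
  exact: is_derive_unique (is_derive_Phi _).
auto_derive; first by exists (phi ((z - s) * L)); exact: is_derive_Phi.
by rewrite e; ring.
Qed.

Lemma is_derive_edgeworth_cdf (L z : R) :
  is_derive (edgeworth_cdf L) z (edgeworth_pdf L z).
Proof.
rewrite /edgeworth_cdf.
have e : Derive (fun x => Phi x) z = phi z by exact: is_derive_unique (is_derive_Phi z).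
have e2 : Derive (fun x => phi x) z = - z * phi z by exact: is_derive_unique (is_derive_phi z).
auto_derive.
  by split; [exists (phi z); exact: is_derive_Phi|split; [exists (- z * phi z); exact: is_derive_phi|]].
by rewrite e e2 /edgeworth_pdf (_ : INR 2 = 2) //; ring.
Qed.

(** Fourier inversion cut off at [T]. By [Ebern_trig] the factor [psi] is turned back into an
    expectation, under which there remains one explicit cosine integral for each value [a] of the
    sum. *)
Lemma is_RInt_pdf_diff (n : nat) (T z : R) :
  let L := ln (INR n) in
  is_RInt (fun t => Re (cis (- (t * z)) * (charf n t * RtoC (gauss (t / L)) - edge L t))%C) 0 T
    (Ebern n (fun a => RInt (fun t => cos (t * (z - standardize L a)) * gauss (/ L * t)) 0 T)
     - cos_gauss T z + kap L * RInt (fun t => t ^ 3 * sin (t * z) * gauss t) 0 T).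
Proof.
move=> L.
have i1 := @is_RInt_Ebern n (fun t a => cos (t * (z - standardize L a)) * gauss (/ L * t))
  (fun a => RInt (fun t => cos (t * (z - standardize L a)) * gauss (/ L * t)) 0 T) 0 T.
have {}i1 := i1 ltac:(move=> a; apply: RInt_correct; apply: RInt_ex_derive => t;
  rewrite /gauss; auto_derive => //).
have i2 : is_RInt (fun t => cos (t * z) * gauss t) 0 T (cos_gauss T z).
  by apply: RInt_correct; exact: RInt_ex_derive (ex_derive_cos_gauss z).
have i3 : is_RInt (fun t => t ^ 3 * sin (t * z) * gauss t) 0 T
            (RInt (fun t => t ^ 3 * sin (t * z) * gauss t) 0 T).
  by apply: RInt_correct; apply: RInt_ex_derive => t; rewrite /gauss; auto_derive.
have := is_RInt_plus _ _ _ _ _ _ (is_RInt_minus _ _ _ _ _ _ i1 i2) (is_RInt_scal _ _ _ (kap L) _ i3).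
apply: is_RInt_ext => t _.
have [e _] := Ebern_trig n (t / sg L) (- (t * z) - t / sg L * (L ^ 2 / 2)).
rewrite (@Ebern_ext n _ (fun a => gauss (t / L) * cos (t / sg L * a + (- (t * z) - t / sg L * (L ^ 2 / 2))))).
  rewrite EbernZ e /charf -/L /edge /Rminus cis_add /minus /plus /opp /scal /= /mult /=.
  by case: (psi n _) => [p1 p2] /=; rewrite cos_neg sin_neg; ring.
move=> a; rewrite Rmult_comm; congr (gauss _ * _); first by rewrite Rmult_comm.
by rewrite -[in LHS]cos_neg; congr cos; rewrite /standardize /Rdiv; ring.
Qed.

Lemma pdf_diff_bound : exists K : R, 0 < K /\ forall (n : nat) (z : R),
  let L := ln (INR n.+1) in 1 <= L ->
  Rabs (smooth_pdf n.+1 z - edgeworth_pdf L z) <= K / L.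
Proof.
have [K [K0 hK]] := charf_edge; exists (K * (PI / 4)); have PI0 := PI_RGT_0.
split; first by apply: Rmult_lt_0_compat; lra.
move=> n z L L1; have L0 : 0 < L by lra.
have h1 := half_mass_ge1.
pose J T := Ebern n.+1 (fun a => RInt (fun t => cos (t * (z - standardize L a)) * gauss (/ L * t)) 0 T)
     - cos_gauss T z + kap L * RInt (fun t => t ^ 3 * sin (t * z) * gauss t) 0 T.
(* The factor [2 * half_mass ^ 2] is [PI], the constant of Fourier inversion on a half line. *)
have lim : is_lim J p_infty (2 * half_mass ^ 2 * (smooth_pdf n.+1 z - edgeworth_pdf L z)).
  have iL := Rinv_0_lt_compat _ L0.
  have l1 := @is_lim_Ebern n.+1 (fun T a => RInt (fun t => cos (t * (z - standardize L a)) * gauss (/ L * t)) 0 T)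
    _ (fun a => @is_lim_cos_gauss_scale (/ L) (z - standardize L a) iL).
  have l2 := @is_lim_cos_gauss z.
  have l3 := is_lim_scal_l _ (kap L) _ _ (@is_lim_sin3_gauss z).
  have := is_lim_plus' _ _ _ _ _ (is_lim_minus' _ _ _ _ _ l1 l2) l3.
  congr (is_lim _ _ (Finite _)).
  rewrite /smooth_pdf -/L (@Ebern_ext n.+1 _ (fun a => 2 * half_mass ^ 2 * (phi ((z - standardize L a) * L) * L))).
    by rewrite EbernZ /edgeworth_pdf phiE; field; lra.
  move=> a; rewrite phiE; have -> : (z - standardize L a) / / L = (z - standardize L a) * L by field; lra.
  by field; lra.
have bd T : 0 < T -> Rabs (J T) <= K / L * (PI / 2).
  move=> T0; have i := @is_RInt_pdf_diff n.+1 T z; rewrite -/L -/(J T) in i.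
  have g : is_RInt (fun t => K / L * / (1 + t²)) 0 T (K / L * atan T).
    have -> : K / L * atan T = minus (K / L * atan T) (K / L * atan 0).
      by rewrite atan_0 /minus /plus /opp /=; ring.
    apply: (@is_RInt_derive _ (fun t => K / L * atan t)) => t _.
      by apply: is_derive_scal; exact: is_derive_atan.
    apply: ex_derive_continuous; rewrite /Rsqr; auto_derive.
    by have := Rle_0_sqr t; rewrite /Rsqr; lra.
  have at2 : K / L * atan T <= K / L * (PI / 2).
    apply: Rmult_le_compat_l; first by apply: Rlt_le; apply: Rdiv_lt_0_compat.
    by have := atan_bound T; lra.
  have pt t : 0 < t < T ->
      Rabs (Re (cis (- (t * z)) * (charf n.+1 t * RtoC (gauss (t / L)) - edge L t))%C)
      <= K / L * / (1 + t²).
    move=> ht; have h := hK n t L1 ltac:(lra); rewrite -/L in h.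
    set w := (_ - _)%C in h *.
    have r := Rmax_Cmod (cis (- (t * z)) * w)%C.
    rewrite Cmod_mult Cmod_cis Rmult_1_l in r.
    apply: Rle_trans (Rmax_l _ _) (Rle_trans _ _ _ r _).
    have -> : K / L * / (1 + t²) = K / (L * (1 + t ^ 2)).
      by rewrite /Rsqr; field; have := one_plus_sq_gt0 t; nra.
    exact: h.
  have ie : ex_RInt (fun t => Re (cis (- (t * z)) * (charf n.+1 t * RtoC (gauss (t / L)) - edge L t))%C) 0 T.
    by exists (J T).
  have ge : ex_RInt (fun t => K / L * / (1 + t²)) 0 T by exists (K / L * atan T).
  have up := RInt_le _ _ 0 T (Rlt_le _ _ T0) ie ge (fun t ht => Rle_trans _ _ _ (Rle_abs _) (pt t ht)).
  have lo := RInt_le _ _ 0 T (Rlt_le _ _ T0) (ex_RInt_opp _ _ _ ge) ie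
    (fun t ht => proj1 (proj1 (Rabs_le_between _ _) (pt t ht))).
  rewrite (is_RInt_unique _ _ _ _ i) (is_RInt_unique _ _ _ _ g) in up.
  rewrite (RInt_opp _ _ _ ge) (is_RInt_unique _ _ _ _ i) (is_RInt_unique _ _ _ _ g) in lo.
  have {}lo : - (K / L * atan T) <= J T := lo.
  have {}up : J T <= K / L * atan T := up.
  by apply/Rabs_le; lra.
have labs := is_lim_Rabs _ _ _ lim.
have lc : is_lim (fun=> K / L * (PI / 2)) p_infty (K / L * (PI / 2)) by exact: is_lim_const.
have := is_lim_le_loc _ _ _ _ _ _ labs lc => /=.
set D := smooth_pdf _ _ - _; move=> h.
have {}h : Rabs (2 * half_mass ^ 2 * D) <= K / L * (PI / 2).
  by apply: h; exists 0 => T; exact: bd.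
rewrite Rabs_mult Rabs_pos_eq in h; last by nra.
have -> : K * (PI / 4) / L = K / L * (PI / 2) / 2 by field; lra.
have m : 2 * Rabs D <= 2 * half_mass ^ 2 * Rabs D.
  by apply: Rmult_le_compat_r; [exact: Rabs_pos|nra].
lra.
Qed.

Lemma gauss_poly_bound (z : R) :
  z ^ 2 * (1 + z ^ 2) * gauss z <= 18 /\ Rabs (z ^ 3 - 3 * z) * gauss z <= 26.
Proof.
have g0 := gauss_gt0 z; have g1 := gauss_le1 z.
have g2 := gauss_le_inv_sq z; have g4 := gauss_pow4 z.
split; first by lra.
have z2 := pow2_ge_0 z.
have a : Rabs (z ^ 3 - 3 * z) <= 1 + z ^ 4 + 3 * (1 + z ^ 2).
  have h1 : Rabs z <= 1 + z ^ 2 by apply/Rabs_le; nra.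
  have h3 : Rabs (z ^ 3) <= 1 + z ^ 4.
    have -> : z ^ 3 = z ^ 2 * z by ring.
    rewrite Rabs_mult (Rabs_pos_eq (z ^ 2)) //.
    have h4 : Rabs z ^ 2 = z ^ 2 by rewrite pow2_abs.
    have h5 := Rabs_pos z.
    have -> : z ^ 4 = z ^ 2 * z ^ 2 by ring.
    rewrite -h4; set r := Rabs z in h5 *.
    by have := pow2_ge_0 (r ^ 2 - r); have := pow2_ge_0 (r - 1); nra.
  apply: Rle_trans (Rabs_triang _ _) _; rewrite Rabs_Ropp Rabs_mult (Rabs_pos_eq 3); lra.
by have := Rmult_le_compat_r _ _ _ (Rlt_le _ _ g0) a; lra.
Qed.

Lemma kap_le1 (L : R) : 1 <= L -> kap L <= 1.
Proof.
move=> L1; rewrite /kap; have s1 : 1 <= sqrt L by rewrite -sqrt_1; apply: sqrt_le_1; lra.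
have s3 : sqrt 3 <= 2.
  by rewrite -(sqrt_square 2); [apply: sqrt_le_1; lra|lra].
apply: (Rmult_le_reg_r (24 * sqrt L)); first by lra.
have -> : 3 * sqrt 3 / (24 * sqrt L) * (24 * sqrt L) = 3 * sqrt 3 by field; lra.
lra.
Qed.

(** The density is at most [1 + 26], uniformly in [L] because [kap L <= 1]. *)
Lemma edgeworth_lipschitz (L x y : R) : 1 <= L ->
  Rabs (edgeworth_cdf L y - edgeworth_cdf L x) <= 27 * Rabs (y - x).
Proof.
move=> L1; apply: (@Rabs_le_MVT (edgeworth_cdf L) (edgeworth_pdf L)) => z _.
  exact: is_derive_edgeworth_cdf.
have [_ h] := gauss_poly_bound z; have g1 := gauss_le1 z; have g0 := gauss_gt0 z.
have p0 := phi_ge0 z; have pg := phi_le_gauss z.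
have k1 := kap_le1 L1; have k0 := @kap_gt0 L ltac:(lra).
rewrite /edgeworth_pdf Rmult_plus_distr_l Rmult_1_r.
apply: Rle_trans (Rabs_triang _ _) _.
rewrite (Rabs_mult (phi z) (_ * _)) (Rabs_mult (kap L)) (Rabs_pos_eq (phi z)) // (Rabs_pos_eq (kap L)); last by lra.
have m : Rabs (z ^ 3 - 3 * z) * phi z <= Rabs (z ^ 3 - 3 * z) * gauss z.
  by apply: Rmult_le_compat_l; [exact: Rabs_pos|].
have m2 : kap L * (Rabs (z ^ 3 - 3 * z) * phi z) <= 1 * 26.
  apply: Rmult_le_compat; try lra.
  by apply: Rmult_le_pos; [exact: Rabs_pos|].
lra.
Qed.

Lemma edgeworth_correction_tail (L z q : R) : 1 <= L -> 0 < q -> q <= Rabs z ->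
  Rabs (kap L * (1 - z ^ 2) * phi z) <= 18 / q ^ 2.
Proof.
move=> L1 q0 qz; have [h _] := gauss_poly_bound z.
have p0 := phi_ge0 z; have pg := phi_le_gauss z.
have k1 := kap_le1 L1; have k0 := @kap_gt0 L ltac:(lra).
have q2 : q ^ 2 <= z ^ 2 by rewrite -(pow2_abs z); apply: pow_incr; lra.
have q20 : 0 < q ^ 2 by apply: pow_lt.
rewrite (Rabs_mult _ (phi z)) (Rabs_mult (kap L)) (Rabs_pos_eq (phi z)) // (Rabs_pos_eq (kap L)); last by lra.
have a : Rabs (1 - z ^ 2) <= 1 + z ^ 2 by apply/Rabs_le; lra.
apply: (Rmult_le_reg_l (q ^ 2)) => //.
have -> : q ^ 2 * (18 / q ^ 2) = 18 by field; lra.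
apply: Rle_trans h.
apply: Rle_trans (_ : q ^ 2 * (1 * (1 + z ^ 2) * gauss z) <= _).
  apply: Rmult_le_compat_l; first by lra.
  apply: Rmult_le_compat => //; last first.
    by apply: Rmult_le_compat => //; [lra|exact: Rabs_pos].
  by apply: Rmult_le_pos; [lra|exact: Rabs_pos].
have g0 := gauss_gt0 z.
rewrite -Rmult_assoc -(Rmult_assoc _ 1) Rmult_1_r; apply: Rmult_le_compat_r; first by lra.
by apply: Rmult_le_compat_r; lra.
Qed.

Lemma smooth_cdf_range (n : nat) (z : R) : 0 <= smooth_cdf n z <= 1.
Proof.
split.
- by rewrite -(Ebern_const n 0); apply: Ebern_le => a; exact: Phi_ge0.
- by rewrite -(Ebern_const n 1); apply: Ebern_le => a; exact: Phi_le1.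
Qed.

Lemma smooth_cdf_le (n : nat) (x y : R) : 0 <= ln (INR n) -> x <= y ->
  smooth_cdf n x <= smooth_cdf n y.
Proof.
move=> L0 xy; apply: Ebern_le => a; apply: Phi_le.
by apply: Rmult_le_compat_r => //; lra.
Qed.

(* The densities are [K / L]-close, hence so are the increments over [-q, q] up to [2 q K / L];
   as both functions have total mass 1, this also controls the tails of [smooth_cdf]. *)
Lemma smooth_cdf_approx : exists K : R, 0 < K /\ forall (n : nat) (q z : R),
  let L := ln (INR n.+1) in 1 <= L -> 1 <= q -> q ^ 3 = L ->
  Rabs (smooth_cdf n.+1 z - edgeworth_cdf L z) <= K / q ^ 2.
Proof.
have [K [K0 hK]] := pdf_diff_bound; exists (26 + 4 * K); split; first by lra.
move=> n q z L L1 q1 qL; have q20 : 0 < q ^ 2 by apply: pow_lt; lra.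
have iq := Rinv_0_lt_compat _ q20.
pose H x := smooth_cdf n.+1 x - edgeworth_cdf L x.
have lip x y : Rabs (H y - H x) <= K / L * Rabs (y - x).
  apply: (@Rabs_le_MVT H (fun x => smooth_pdf n.+1 x - edgeworth_pdf L x)) => u _.
    by apply: is_derive_minus; [exact: is_derive_smooth_cdf|exact: is_derive_edgeworth_cdf].
  exact: hK.
(* The choice [q ^ 3 = L] makes the error integrated over [[-q, q]] of the same order [q^{-2}] as
   the tails. *)
have KL : K / L * (2 * q) = 2 * K / q ^ 2 by rewrite -qL; field; lra.
have pt := @Phi_tail q ltac:(lra).
have e := Phi_opp q.
have sr x := smooth_cdf_range n.+1 x.
have mono x y : x <= y -> smooth_cdf n.+1 x <= smooth_cdf n.+1 y.
  by apply: smooth_cdf_le; rewrite -/L; lra.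
have inc : Rabs (H q - H (- q)) <= 2 * K / q ^ 2.
  apply: Rle_trans (lip _ _) _; rewrite -KL; apply: Req_le; congr Rmult.
  by rewrite Rabs_pos_eq; lra.
have Gd : edgeworth_cdf L q - edgeworth_cdf L (- q) = 1 - 2 * Phi (- q).
  rewrite /edgeworth_cdf !phiE gauss_opp.
  have -> : (- q) ^ 2 = q ^ 2 by ring.
  lra.
have {}inc := proj1 (proj1 (Rabs_le_between _ _) inc).
have mass : 1 - (4 + 2 * K) / q ^ 2 <= smooth_cdf n.+1 q - smooth_cdf n.+1 (- q).
  by move: inc; rewrite /H; rewrite /Rdiv in pt *; lra.
have Glow x : x <= - q -> Rabs (edgeworth_cdf L x) <= 20 / q ^ 2.
  move=> xq; have := @edgeworth_correction_tail L x q L1 ltac:(lra) _ => c.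
  have {}c := c ltac:(rewrite Rabs_left; lra).
  apply: Rle_trans (Rabs_triang _ _) _; rewrite Rabs_pos_eq; last exact: Phi_ge0.
  by have := Phi_le xq; rewrite /Rdiv in pt c *; lra.
have Gup x : q <= x -> Rabs (edgeworth_cdf L x - 1) <= 20 / q ^ 2.
  move=> xq; have := @edgeworth_correction_tail L x q L1 ltac:(lra) _ => c.
  have {}c := c ltac:(rewrite Rabs_pos_eq; lra).
  have -> : edgeworth_cdf L x - 1 = (Phi x - 1) + kap L * (1 - x ^ 2) * phi x.
    by rewrite /edgeworth_cdf; ring.
  apply: Rle_trans (Rabs_triang _ _) _.
  have p1 := Phi_le1 x; rewrite Rabs_left1; last by lra.
  by have := Phi_le xq; rewrite /Rdiv in pt c *; lra.
have s1 := sr q; have s2 := sr (- q); have s3 := sr z.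
have B : (26 + 4 * K) / q ^ 2 = 20 / q ^ 2 + (4 + 2 * K) / q ^ 2 + 2 * K / q ^ 2 + 2 / q ^ 2.
  by field; lra.
have K2 : 0 < 2 * K / q ^ 2 by apply: Rdiv_lt_0_compat; lra.
have K3 : 0 < 2 / q ^ 2 by apply: Rdiv_lt_0_compat; lra.
have K4 : 0 < (4 + 2 * K) / q ^ 2 by apply: Rdiv_lt_0_compat; lra.
rewrite B; case: (Rle_lt_dec z (- q)) => z1.
  have := Glow z z1; have := mono z (- q) z1 => m /Rabs_le_between g.
  by apply/Rabs_le; lra.
case: (Rle_lt_dec q z) => z2.
  have := Gup z z2; have := mono q z z2 => m /Rabs_le_between g.
  by apply/Rabs_le; lra.
(* For [z] inside the interval, the density error is integrated from [- q], where both functions are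
   already known to be small. *)
have l := lip (- q) z.
have : K / L * Rabs (z - - q) <= 2 * K / q ^ 2.
  rewrite -KL; apply: Rmult_le_compat_l; first by apply: Rlt_le; apply: Rdiv_lt_0_compat; lra.
  by rewrite Rabs_pos_eq; lra.
move=> l2; have {}l := proj1 (Rabs_le_between _ _) (Rle_trans _ _ _ l l2).
have g := proj1 (Rabs_le_between _ _) (Glow (- q) (Rle_refl _)).
by move: l; rewrite /H => l; apply/Rabs_le; lra.
Qed.

(** * Transfer to the statistic *)

Definition invol_stat (n : nat) (c : nat -> nat) : R :=
  (ln (invol n c) - / 2 * ln (INR n) ^ 2) / sqrt (/ 3 * ln (INR n) ^ 3).

Lemma prob_stat_leE (n : nat) (x : R) :
  prob_stat_le n x = Ecyc n (fun l => INR (Rleb (invol_stat n (fun j => count_mem j l)) x)).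
Proof. exact: (perm_prob_Ecyc n (fun c => Rleb (invol_stat n c) x)). Qed.

Section Sandwich.
Variables (n : nat) (x eta : R) (l : seq nat).
Hypotheses (sl : sumn l = n) (al : all (fun k => 0 < k)%nat l) (L1 : 1 <= ln (INR n))
  (eta0 : 0 < eta).

Let L := ln (INR n).
Let a := log_remainders l.
Let D := log_lengths l - a.
Let S := invol_stat n (fun j => count_mem j l).

Let L0 : 0 < L.
Proof. by rewrite /L; lra. Qed.

Let s0 : 0 < eta * sg L.
Proof. by apply: Rmult_lt_0_compat => //; exact: sg_gt0. Qed.

Let S_bounds : log_lengths l <= sg L * S + L ^ 2 / 2 <= log_lengths l + repeated_lengths l.
Proof.
have := ln_invol_bounds al; rewrite sl; set V := ln (invol _ _).
have s := sg_gt0 L0.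
suff -> : sg L * S + L ^ 2 / 2 = V by [].
by rewrite /S /invol_stat -/V -/L -/(sg L); field; lra.
Qed.

(** Chebyshev's inequality before taking expectations: the indicator of a large [D] is dominated by
    this quotient. *)
Let large_D : eta * sg L <= Rabs D -> 1 <= D ^ 2 / (eta * sg L) ^ 2.
Proof.
move=> h; have p : 0 < (eta * sg L) ^ 2 by apply: pow_lt.
apply: (Rmult_le_reg_r ((eta * sg L) ^ 2)) => //.
have -> : D ^ 2 / (eta * sg L) ^ 2 * (eta * sg L) ^ 2 = D ^ 2.
  by rewrite /Rdiv Rmult_assoc Rinv_l ?Rmult_1_r //; lra.
by rewrite Rmult_1_l -(pow2_abs D); apply: pow_incr; lra.
Qed.

Let D_ge0 : 0 <= D ^ 2 / (eta * sg L) ^ 2.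
Proof.
apply: Rmult_le_pos; first exact: pow2_ge_0.
by apply: Rlt_le; apply: Rinv_0_lt_compat; apply: pow_lt.
Qed.

Let repeated_ge0 : 0 <= repeated_lengths l.
Proof. by have := S_bounds; lra. Qed.

Let aE : a = standardize L a * sg L + L ^ 2 / 2.
Proof. by rewrite /standardize; field; have := sg_gt0 L0; lra. Qed.

(** Unless [D] is large, [S <= x] forces [standardize L a <= x + eta]. The second [eta] is the
    margin that makes the smoothed indicator at least [Phi (eta * L) = 1 - Phi (- (eta * L))]. *)
Lemma indicator_le :
  INR (Rleb S x) <= Phi ((x + 2 * eta - standardize L a) * L) + Phi (- (eta * L))
                    + D ^ 2 / (eta * sg L) ^ 2.
Proof.
have p1 := Phi_ge0 ((x + 2 * eta - standardize L a) * L); have p2 := Phi_ge0 (- (eta * L)).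
have d0 := D_ge0; have s := sg_gt0 L0.
rewrite /Rleb; case: Rle_dec => hS; last by rewrite -[INR false]/(INR 0) INR_0; lra.
rewrite -[INR true]/(INR 1) INR_1; case: (Rle_lt_dec (eta * sg L) (Rabs D)) => hD; first by have := large_D hD; lra.
have hD2 : - (eta * sg L) < D by have := proj1 (Rabs_def2 _ _ hD); have := proj2 (Rabs_def2 _ _ hD); lra.
have hx : standardize L a <= x + eta.
  apply: (Rmult_le_reg_r (sg L)) => //; have [b1 b2] := S_bounds.
  have : sg L * S <= sg L * x by apply: Rmult_le_compat_l; lra.
  by move: aE hD2; rewrite /D -/a; lra.
have : Phi (eta * L) <= Phi ((x + 2 * eta - standardize L a) * L).
  by apply: Phi_le; apply: Rmult_le_compat_r; lra.
have := Phi_opp (eta * L); lra.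
Qed.

(** As above with a third [eta], because [repeated_lengths] can push [S] upwards; Markov's
    inequality accounts for its being large. *)
Lemma indicator_ge :
  Phi ((x - 3 * eta - standardize L a) * L) - Phi (- (eta * L))
    - D ^ 2 / (eta * sg L) ^ 2 - repeated_lengths l / (eta * sg L)
  <= INR (Rleb S x).
Proof.
have p1 := Phi_le1 ((x - 3 * eta - standardize L a) * L); have p2 := Phi_ge0 (- (eta * L)).
have d0 := D_ge0; have s := sg_gt0 L0.
have q0 : 0 <= repeated_lengths l / (eta * sg L).
  by apply: Rmult_le_pos => //; apply: Rlt_le; apply: Rinv_0_lt_compat.
rewrite /Rleb; case: Rle_dec => hS; first by rewrite -[INR true]/(INR 1) INR_1; lra.
rewrite -[INR false]/(INR 0) INR_0; case: (Rle_lt_dec (eta * sg L) (Rabs D)) => hD; first by have := large_D hD; lra.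
case: (Rle_lt_dec (eta * sg L) (repeated_lengths l)) => hq.
  have : 1 <= repeated_lengths l / (eta * sg L).
    by apply: (Rmult_le_reg_r (eta * sg L)) => //; rewrite /Rdiv Rmult_assoc Rinv_l; lra.
  lra.
have hD2 : D < eta * sg L by have := proj1 (Rabs_def2 _ _ hD).
have hx : x - 2 * eta <= standardize L a.
  apply: (Rmult_le_reg_r (sg L)) => //; have [b1 b2] := S_bounds.
  have : sg L * x <= sg L * S by apply: Rmult_le_compat_l; lra.
  by move: aE hD2; rewrite /D -/a; lra.
have : Phi ((x - 3 * eta - standardize L a) * L) <= Phi (- (eta * L)).
  by apply: Phi_le; rewrite -Ropp_mult_distr_l_reverse; apply: Rmult_le_compat_r; lra.
lra.
Qed.

End Sandwich.

Lemma prob_stat_approx (n : nat) (x eta : R) : 1 <= ln (INR n.+1) -> 0 < eta ->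
  let L := ln (INR n.+1) in
  smooth_cdf n.+1 (x - 3 * eta) - Phi (- (eta * L)) - 256 * L / (eta * sg L) ^ 2
    - 2 / (eta * sg L)
  <= prob_stat_le n.+1 x
  <= smooth_cdf n.+1 (x + 2 * eta) + Phi (- (eta * L)) + 256 * L / (eta * sg L) ^ 2.
Proof.
move=> L1 e0 L; rewrite prob_stat_leE; have L0 : 0 < L by rewrite /L; lra.
have s0 : 0 < eta * sg L by apply: Rmult_lt_0_compat => //; exact: sg_gt0.
have is0 := Rinv_0_lt_compat _ s0.
have s2 : 0 < / (eta * sg L) ^ 2 by apply: Rinv_0_lt_compat; apply: pow_lt.
have D2 : / (eta * sg L) ^ 2 * Ecyc n.+1 (fun l => (log_lengths l - log_remainders l) ^ 2)
          <= 256 * L / (eta * sg L) ^ 2.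
  rewrite /Rdiv Rmult_comm; apply: Rmult_le_compat_r; first by lra.
  (* Here [128 * (1 + L) <= 256 * L] since [L >= 1]. *)
  apply: Rle_trans (Ecyc_log_diff_sq n.+1) _; have := harmonic_le n; rewrite -/L /L; lra.
have Q2 : / (eta * sg L) * Ecyc n.+1 repeated_lengths <= 2 / (eta * sg L).
  by rewrite /Rdiv Rmult_comm; apply: Rmult_le_compat_r; [lra|exact: Ecyc_repeated].
pose f b := fun l => Phi ((b - standardize L (log_remainders l)) * L).
have fE b : Ecyc n.+1 (f b) = smooth_cdf n.+1 b.
  exact: (Ecyc_log_remainders n.+1 (fun a => Phi ((b - standardize L a) * L))).
split.
- apply: Rle_trans (Ecyc_le (g := fun l => (1 * f (x - 3 * eta) l + (-1) * (Phi (- (eta * L))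
      + / (eta * sg L) ^ 2 * (log_lengths l - log_remainders l) ^ 2
      + / (eta * sg L) * repeated_lengths l))) _).
    by rewrite Ecyc_lin !EcycD !EcycZ Ecyc_const fE; lra.
  move=> l sl al; have := @indicator_ge n.+1 x eta l sl al L1 e0.
  by rewrite -/L /f /Rdiv; lra.
- apply: Rle_trans (Ecyc_le (h := fun l => (f (x + 2 * eta) l + (Phi (- (eta * L))
      + / (eta * sg L) ^ 2 * (log_lengths l - log_remainders l) ^ 2))) _) _.
    move=> l sl al; have := @indicator_le n.+1 x eta l sl al L1 e0.
    by rewrite -/L /f /Rdiv; lra.
  by rewrite !EcycD !EcycZ Ecyc_const fE; lra.
Qed.

Lemma prob_stat_edgeworth : exists K : R, 0 < K /\ forall (n : nat) (q x : R),
  let L := ln (INR n.+1) in 1 <= L -> 1 <= q -> q ^ 3 = L ->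
  Rabs (prob_stat_le n.+1 x - edgeworth_cdf L x) <= K / q ^ 2.
Proof.
(* The lower bound is the worse one: [855 = 3 * 27 + 2 + 768 + 4], for the shift by [3 * eta], the
   normal tail, the Chebyshev term and the repeated lengths. *)
have [K [K0 hK]] := smooth_cdf_approx; exists (K + 855); split; first by lra.
move=> n q x L L1 q1 qL; have L0 : 0 < L by lra.
have q2 : 0 < q ^ 2 by apply: pow_lt; lra.
(* So [eta] is [L^{-2/3}], which balances the cost [27 * eta] per unit of shift against the
   Chebyshev term [768 / (eta * L)^2]. *)
pose eta := / q ^ 2; have e0 : 0 < eta by apply: Rinv_0_lt_compat.
have [lo up] := prob_stat_approx x L1 e0; rewrite -/L in lo up.
have eL : eta * L = q by rewrite /eta -qL; field; lra.
have p := @Phi_tail q ltac:(lra).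
have s0 := sg_gt0 L0.
have es2 : (eta * sg L) ^ 2 = q ^ 5 / 3.
  by rewrite Rpow_mult_distr sg_sq // /eta -qL; field; lra.
have t1 : 256 * L / (eta * sg L) ^ 2 = 768 / q ^ 2 by rewrite es2 -qL; field; lra.
have es0 : 0 < eta * sg L by apply: Rmult_lt_0_compat.
have es : q ^ 2 / 2 <= eta * sg L.
  apply: Rsqr_incr_0_var; last by lra.
  rewrite /Rsqr; have -> : eta * sg L * (eta * sg L) = q ^ 5 / 3 by rewrite -es2; ring.
  have q4 := pow_lt q 4 ltac:(lra).
  have -> : q ^ 5 = q * q ^ 4 by ring.
  have -> : q ^ 2 / 2 * (q ^ 2 / 2) = q ^ 4 / 4 by field.
  nra.
have t2 : 2 / (eta * sg L) <= 4 / q ^ 2.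
  apply: (Rmult_le_reg_r (eta * sg L * q ^ 2)); first exact: Rmult_lt_0_compat.
  have -> : 2 / (eta * sg L) * (eta * sg L * q ^ 2) = 2 * q ^ 2 by field; lra.
  have -> : 4 / q ^ 2 * (eta * sg L * q ^ 2) = 4 * (eta * sg L) by field; lra.
  lra.
rewrite eL t1 in lo up.
have h1 := proj1 (Rabs_le_between _ _) (hK n q (x - 3 * eta) L1 q1 qL).
have h2 := proj1 (Rabs_le_between _ _) (hK n q (x + 2 * eta) L1 q1 qL).
rewrite -/L in h1 h2.
have g1 := proj1 (Rabs_le_between _ _) (edgeworth_lipschitz x (x - 3 * eta) L1).
have g2 := proj1 (Rabs_le_between _ _) (edgeworth_lipschitz x (x + 2 * eta) L1).
rewrite (Rabs_left (_ - _)) in g1; last by lra.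
rewrite (Rabs_pos_eq (_ - _)) in g2; last by lra.
have -> : (K + 855) / q ^ 2 = K / q ^ 2 + 855 * eta by rewrite /eta; field; lra.
have e1 : 768 / q ^ 2 = 768 * eta by [].
have e2 : 2 / q ^ 2 = 2 * eta by [].
have e4 : 4 / q ^ 2 = 4 * eta by [].
rewrite e1 e2 e4 in lo up t2 p.
by apply/Rabs_le; lra.
Qed.

Theorem theorem5p8 :
  exists (K : R) (N : nat), forall n : nat, (N <= n)%nat -> forall x : R,
    (Rabs (prob_stat_le n x - Phi x
           - (3 * sqrt 3) / (24 * sqrt (2 * PI))
             * ((1 - x ^ 2) * exp (- x ^ 2 / 2)) / sqrt (ln (INR n)))
     <= K * Rpower (ln (ln (INR n)) / ln (INR n)) (2 / 3))%R.
Proof.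
have [K [K0 hK]] := prob_stat_edgeworth.
(* This threshold guarantees [ln (ln (INR n)) >= 1]. *)
have [N hN] := INR_unbounded (exp (exp 1)).
exists K, N => -[|n] hn x.
  by move: hN; rewrite (_ : N = 0%nat) ?INR_0; [have := exp_pos (exp 1); lra|lia].
set L := ln (INR n.+1).
have eL : exp 1 <= L.
  rewrite -[exp 1]ln_exp; apply: ln_le; first exact: exp_pos.
  by apply: Rle_trans (_ : INR N <= _); [lra|apply: le_INR; lia].
have e1 : 1 + 1 <= exp 1 := exp_ineq1_le 1.
have lL : 1 <= ln L by rewrite -[1]ln_exp; apply: ln_le; [exact: exp_pos|].
pose q := exp (ln L / 3).
have q1 : 1 <= q by rewrite -exp_0; apply: exp_mono; lra.
have qL : q ^ 3 = L.
  rewrite -exp_INR_mul -[RHS]exp_ln; last by lra.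
  by congr exp; rewrite INR_IZR_INZ -[IZR _]/3; field.
have L1 : 1 <= L by lra.
have h := hK n q x L1 q1 qL; rewrite -/L in h.
have h1 := half_mass_gt0; have s := sqrt_lt_R0 L ltac:(lra).
have -> : prob_stat_le n.+1 x - Phi x
  - 3 * sqrt 3 / (24 * sqrt (2 * PI)) * ((1 - x ^ 2) * exp (- x ^ 2 / 2)) / sqrt L
  = prob_stat_le n.+1 x - edgeworth_cdf L x.
  by rewrite /edgeworth_cdf /phi /kap /gauss sqrt_2PI; field; lra.
apply: Rle_trans h _; apply: Rmult_le_compat_l; first by lra.
(* The error is now at most [K * L^{-2/3}]. The bound to be reached has the further factor
   [(ln L)^{2/3}], which is at least 1. *)
have -> : q ^ 2 = exp (2 / 3 * ln L).
  by rewrite -exp_INR_mul; congr exp; rewrite (_ : INR 2 = 2) //; field.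
rewrite -exp_Ropp /Rpower ln_div; try lra.
have l0 : 0 <= ln (ln L) by rewrite -ln_1; apply: ln_le; lra.
by apply: exp_mono; lra.
Qed.
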